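(* There exists a (sufficiently large) constant $K>0$ such that for every $d\ge 2$ and every $p=p(n)\in[0,1]$ with $p\ge \frac{K\log n}{n}$, $$T(\mathcal X_{n,p})=\Theta\left(\frac{n^{\frac{d-1}{d}}}{p^{1/d}}\right)\qquad\text{a.a.s.};$$ that is, there are positive constants $c,C$ such that a.a.s. $c\,n^{(d-1)/d}p^{-1/d}\le T(\mathcal X_{n,p})\le C\,n^{(d-1)/d}p^{-1/d}$.
   Context: $d$ is a fixed integer. $\mathcal X_{n,p}$ is the following random graph. Points $X_1,\dots,X_n$ are chosen independently and uniformly at random in the cube $[0,1]^d$; vertex $i\in[n]$ is placed at $X_i$. Independently of the positions, each pair of vertices is joined by an edge independently with probability $p$. Each edge has length equal to the Euclidean distance between its endpoints. $T(\mathcal X_{n,p})$ is the minimum total edge length of a Traveling Salesperson tour, i.e. a Hamilton cycle of $\mathcal X_{n,p}$ (a cycle using only edges of the graph and visiting every vertex exactly once); set $T=+\infty$ if there is none. A sequence of events $\mathcal E_n$ holds asymptotically almost surely (a.a.s.) if $\lim_{n\to\infty}\Pr(\neg\mathcal E_n)=0$. *)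

(* Defs.v *)
From HB Require Import structures.
From mathcomp Require Import all_boot all_order all_algebra.
From mathcomp Require Import all_classical all_reals all_analysis.
Import numFieldNormedType.Exports.

Set Implicit Arguments.
Unset Strict Implicit.
Unset Printing Implicit Defensive.

Import Order.TTheory GRing.Theory Num.Theory.

Local Open Scope classical_set_scope.
Local Open Scope ring_scope.

(* Lebesgue measure on R^d, for measurable sets, by integrating the measures
   of the sections; this is what the library's product measure unfolds to,
   transported from nested pairs to tuples. *)
Fixpoint lebesgue_tuple (R : realType) (d : nat) :
    set (d.-tuple R) -> \bar R :=
  match d with
  | 0 => fun A => \d_([tuple] : 0.-tuple R) A
  | d'.+1 => fun A => (\int[lebesgue_measure]_(x in [set: R])
      lebesgue_tuple [set t : d'.-tuple R | A [tuple of (x : R) :: t]])%E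
  end.

Definition unit_cube (R : realType) (d : nat) : set (d.-tuple R) :=
  [set x | forall j : 'I_d, 0 <= tnth x j <= 1].

(* The norm the library puts on row vectors is the sup norm, hence an explicit
   Euclidean distance. *)
Definition euclidean_dist (R : realType) (d : nat) (x y : d.-tuple R) : R :=
  Num.sqrt (\sum_(j < d) (tnth x j - tnth y j) ^+ 2).

Section Probability.
Context {R : realType} {disp : measure_display} {Omega : measurableType disp}.
Variable P : probability Omega R.

(* Mutual independence of a finite family of classes of events. *)
Definition mutually_independent (I : finType) (F : I -> set (set Omega)) :=
  forall (J : {set I}) (A : I -> set Omega),
    (forall i, i \in J -> F i (A i)) ->
    (P (\bigcap_(i in [set` J]) A i) = \prod_(i in J) P (A i))%E.

Definition uniform_on_cube (d : nat) (X : Omega -> d.-tuple R) :=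
  measurable_fun [set: Omega] X /\
  forall A : set (d.-tuple R), measurable A ->
    P (X @^-1` A) = lebesgue_tuple (A `&` @unit_cube R d).

Definition vertex_pair (n : nat) : finType :=
  {ij : 'I_n * 'I_n | (ij.1 < ij.2)%N}.

(* The events determined by the position of one vertex, respectively by the
   presence of one edge. *)
Definition generated_events (d n : nat) (X : 'I_n -> Omega -> d.-tuple R)
    (G : Omega -> rel 'I_n) (k : 'I_n + vertex_pair n) : set (set Omega) :=
  match k with
  | inl i => [set X i @^-1` A | A in measurable]
  | inr ij => [set [set w | B (G w (val ij).1 (val ij).2)] | B in [set: set bool]]
  end.

(* [X i w] is the position of vertex [i], [G w] the adjacency relation. *)
Record embedded_random_graph (d n : nat) (p : R)
    (X : 'I_n -> Omega -> d.-tuple R) (G : Omega -> rel 'I_n) : Prop := {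
  position_uniform : forall i, uniform_on_cube (X i) ;
  graph_irreflexive : forall w, irreflexive (G w) ;
  graph_symmetric : forall w, symmetric (G w) ;
  edge_measurable : forall i j, measurable [set w | G w i j] ;
  edge_probability : forall i j, i != j -> P [set w | G w i j] = p%:E ;
  joint_independence : mutually_independent (generated_events X G) }.

End Probability.

Section TSP.
Context {R : realType} {d n : nat}.
Variables (x : 'I_n -> d.-tuple R) (e : rel 'I_n).

(* A duplicate-free n-tuple of vertices visits all n of them; [2 < n] excludes
   the degenerate closed walks that [ucycle] accepts on fewer vertices. *)
Definition hamilton_cycle (s : n.-tuple 'I_n) : bool :=
  (2 < n)%N && ucycleb e s.

Definition tour_length (s : n.-tuple 'I_n) : R :=
  \sum_(i <- s) euclidean_dist (x i) (x (next s i)).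

Definition tsp : \bar R :=
  \big[Order.min/+oo%E]_(s : n.-tuple 'I_n | hamilton_cycle s)
    (tour_length s)%:E.

End TSP.

(* The probability space may change with n. *)
Definition asymptotically_almost_surely (R : realType)
    (disp : nat -> measure_display)
    (Omega : forall n, measurableType (disp n))
    (P : forall n, probability (Omega n) R)
    (E : forall n, set (Omega n)) : Prop :=
  P n (~` E n) @[n --> \oo] --> 0%E.

(* n^((d-1)/d) / p^(1/d) *)
Definition tsp_rate (R : realType) (d n : nat) (p : R) : R :=
  n%:R `^ ((d%:R - 1) / d%:R) / p `^ (d%:R^-1).

(* Main.v *)
Require Import Defs.
From mathcomp Require Import all_boot all_order all_algebra.
From mathcomp Require Import all_classical all_reals all_analysis.
From mathcomp Require Import measurable_realfun.
From mathcomp Require Import ring lra zify.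
Import numFieldNormedType.Exports.
Import Order.TTheory GRing.Theory Num.Theory.

Set Implicit Arguments.
Unset Strict Implicit.
Unset Printing Implicit Defensive.

(** Positions matter only through the cells of a grid, and the pair (cells, edges)
    has a product law, so both bounds are finite union bounds. Put y = n p.

    Lower bound: for a grid of about y cells, E[2^-D] for the l1 distance D of the
    cells of two random points is O(1/y), so the expected number of Hamilton paths
    of G along which D adds up to at most 2dn is at most
    n! p^(n-1) 2^(2dn) O(1/y)^(n-1), which tends to 0.

    Upper bound, for every choice of the positions: expose G as a union G1 u G2 with
    1 - p = (1 - q)^2. Run through dyadic grids, from about y cells to one cell, and
    merge paths inside each cell by depth-first search; what remains unmerged gives
    two sets, equally distributed over the cells, without G1-edges inside cells, and
    by a union bound these have at most n/3^k vertices on the k-th grid. The result is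
    a partition into n 3^-J paths with 2^J ~ y^(1/d), of length O(n 2^-J). View it as
    an order of the vertices with gaps (missing edges). Posa rotations, started at all
    m gaps simultaneously, reach linearly many ends after O(log(n/m)) steps because G1
    expands; doing this on both sides, quadratically many pairs would close a gap, and
    by a union bound over all orders one of them is in G2. Thus a gap costs
    O(log(n/m)) edges, and as the sum of log(n/m) over m <= n 3^-J is O(n 2^-J), these
    edges may be arbitrarily long. *)

(** * Links and rotations of a sequence *)

(** Why the number of paths is divided by 3 at each level: cell diameters double, so the number of
    paths must fall by more than 2 for the added lengths to form a convergent geometric series
    (ratio 2/3), while the number of cells, below which merging inside cells cannot go, falls only
    by 2^d. As d is at least 2, the base 3 lies strictly between 2 and 2^d. The margin between 2 and
    3 also pays for the logarithm in the gap phase: about n/3^i gaps at O(i) edges each cost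
    O(n/2^i). The obstacle in the gap phase is adaptivity. After one gap has been closed the current
    order depends on G2, so G2 cannot be treated as fresh. No conditioning is used: the statement
    about G2 is demanded of all orders at once, with a record of which of their links are edges.
    These are at most n^(3n) choices, while a quadratic number of pairs avoids G2 with probability
    at most n^(-4n) once qn is a large multiple of log n. Edges found by rotations have uncontrolled
    length; therefore rotations are charged by number, against weights bounded by 1. *)

Definition steps (T : Type) (s : seq T) : seq (T * T) := zip s (behead s).

Lemma steps_cons2 (T : Type) (x y : T) s :
  steps (x :: y :: s) = (x, y) :: steps (y :: s).
Proof. by []. Qed.

Lemma steps_cat (T : Type) (s1 : seq T) y z s2 :
  steps (rcons s1 y ++ z :: s2) = steps (rcons s1 y) ++ (y, z) :: steps (z :: s2).
Proof.
elim: s1 => [|x [|x' s1] IH] //.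
by rewrite !rcons_cons !cat_cons steps_cons2 -cat_cons -rcons_cons IH.
Qed.

Lemma steps_rcons2 (T : Type) (s : seq T) y z :
  steps (rcons (rcons s y) z) = rcons (steps (rcons s y)) (y, z).
Proof. by rewrite -[rcons (rcons s y) z]cats1 steps_cat /= cats1. Qed.

Definition swap (T : Type) (q : T * T) := (q.2, q.1).

Lemma steps_rev (T : Type) (s : seq T) :
  steps (rev s) = rev (map (@swap T) (steps s)).
Proof.
elim: s => [|x [|y s] IH] //.
by rewrite steps_cons2 map_cons [RHS]rev_cons -IH !rev_cons steps_rcons2.
Qed.

Lemma unzip1_steps (T : Type) x (s : seq T) :
  rcons (unzip1 (steps (x :: s))) (last x s) = x :: s.
Proof. by elim: s x => [|y s IH] x //=; congr (_ :: _); apply: IH. Qed.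

Lemma unzip2_steps (T : Type) (s : seq T) : unzip2 (steps s) = behead s.
Proof. by case: s => [|x s] //; elim: s x => [|y s IH] x //=; congr (_ :: _); apply: IH. Qed.

Lemma size_steps (T : Type) (s : seq T) : size (steps s) = (size s).-1.
Proof. by rewrite -(size_map snd) [map _ _]unzip2_steps size_behead. Qed.

Lemma path_steps (T : Type) (e : rel T) x s :
  path e x s = all (fun q => e q.1 q.2) (steps (x :: s)).
Proof. by elim: s x => [|y s IH] x //=; rewrite IH. Qed.

Section StepsEq.
Variable T : eqType.
Implicit Types s : seq T.

Lemma uniq_unzip1_steps s : uniq s -> uniq (unzip1 (steps s)).
Proof.
by case: s => [|x s] //; rewrite -{1}(unzip1_steps x s) rcons_uniq => /andP[].
Qed.

Lemma uniq_unzip2_steps s : uniq s -> uniq (unzip2 (steps s)).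
Proof. by rewrite unzip2_steps; case: s => [|x s] //= /andP[]. Qed.

Lemma unzip1_inj (U : eqType) (l : seq (T * U)) x y y' :
  uniq (unzip1 l) -> (x, y) \in l -> (x, y') \in l -> y = y'.
Proof.
elim: l => [|[a b] l IH] //= /andP[al ul]; rewrite !inE !xpair_eqE.
case/orP=> [/andP[/eqP-> /eqP->]|xl]; case/orP=> [/andP[/eqP ? /eqP->]|xl'] //.
- by case/negP: al; apply: (map_f fst xl').
- by subst a; case/negP: al; apply: (map_f fst xl).
- exact: IH.
Qed.

Lemma unzip2_inj (U : eqType) (l : seq (U * T)) x x' y :
  uniq (unzip2 l) -> (x, y) \in l -> (x', y) \in l -> x = x'.
Proof.
elim: l => [|[a b] l IH] //= /andP[al ul]; rewrite !inE !xpair_eqE.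
case/orP=> [/andP[/eqP-> /eqP->]|xl]; case/orP=> [/andP[/eqP-> /eqP ?]|xl'] //.
- by case/negP: al; apply: (map_f snd xl').
- by subst b; case/negP: al; apply: (map_f snd xl).
- exact: IH.
Qed.

Definition adj s (u v : T) := ((u, v) \in steps s) || ((v, u) \in steps s).

Lemma stepsP s u v :
  reflect (exists a b, s = rcons a u ++ v :: b) ((u, v) \in steps s).
Proof.
apply: (iffP idP) => [|[a [b ->]]]; last first.
  by rewrite steps_cat mem_cat inE eqxx orbT.
elim: s => [|x [|y s] IH] //; rewrite steps_cons2 inE => /orP[/eqP[-> ->]|/IH].
  by exists [::], s.
by case=> [a [b E]]; exists (x :: a), b; rewrite E.
Qed.

End StepsEq.

(* Posa rotation: the link (last of [a], head of [b]) is traded for (last of [a], last of [b]). *)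
Definition rotation (T : Type) (a b : seq T) := a ++ rev b.

Section Rotation.
Variable T : eqType.
Implicit Types (a b : seq T) (y z : T).

Lemma perm_rotation a b : perm_eq (rotation a b) (a ++ b).
Proof. by rewrite /rotation perm_cat2l perm_rev. Qed.

Lemma last_rotation x a z b : last x (rotation a (z :: b)) = z.
Proof. by rewrite /rotation rev_cons last_cat last_rcons. Qed.

Lemma rev_cons_last z b : exists b', rev (z :: b) = last z b :: b'.
Proof.
by rewrite lastI rev_rcons; exists (rev (belast z b)).
Qed.

(** Reversing the tail only swaps the ends of its links, so exactly one link is traded. *)
Lemma steps_rotation a y z b :
  exists l1 l2, [/\ steps (rcons a y ++ z :: b) = l1 ++ (y, z) :: l2 &
   steps (rotation (rcons a y) (z :: b)) =
     l1 ++ (y, last z b) :: rev (map (@swap T) l2)].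
Proof.
exists (steps (rcons a y)), (steps (z :: b)); rewrite steps_cat; split=> //.
rewrite /rotation; have [b' E] := rev_cons_last z b.
by rewrite E steps_cat -E steps_rev.
Qed.

Lemma count_rotation (P : rel T) a y z b : symmetric P ->
  (count (fun q => P q.1 q.2) (steps (rotation (rcons a y) (z :: b))) + P y z =
   count (fun q => P q.1 q.2) (steps (rcons a y ++ z :: b)) + P y (last z b))%N.
Proof.
move=> sP; have [l1 [l2 [-> ->]]] := steps_rotation a y z b.
rewrite !count_cat /= count_rev count_map.
rewrite (eq_count (a2 := fun q => P q.1 q.2)); last by move=> q /=; rewrite sP.
by lia.
Qed.

(** The only adjacency lost is that of [y] and [z]. It is charged to [z], the new last vertex, which
    joins the set of ends in Posa's argument. *)
Lemma adj_rotation a y z b u v : adj (rcons a y ++ z :: b) u v ->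
  [\/ adj (rotation (rcons a y) (z :: b)) u v, u = z | v = z].
Proof.
have [l1 [l2 [E1 E2]]] := steps_rotation a y z b.
have sw p q : ((p, q) \in l2) = ((q, p) \in rev (map (@swap T) l2)).
  rewrite mem_rev -[(q, p)]/(swap (p, q)) mem_map //.
  by move=> [? ?] [? ?] [-> ->].
rewrite /adj E1 E2 !mem_cat !inE !xpair_eqE !sw.
case/orP=> /or3P[->|/andP[/eqP-> /eqP->]|->]; rewrite ?orbT;
  by [apply: Or31|apply: Or32|apply: Or33].
Qed.

End Rotation.

Section WSum.
Variables (T : eqType) (A : nmodType).
Implicit Types (F : T -> T -> A) (s : seq T).
Local Open Scope ring_scope.

Definition wsum F s : A := \sum_(q <- steps s) F q.1 q.2.

Lemma wsum_nil F : wsum F [::] = 0.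
Proof. by rewrite /wsum big_nil. Qed.

Lemma wsum_seq1 F x : wsum F [:: x] = 0.
Proof. by rewrite /wsum big_nil. Qed.

Lemma wsum_cat F s1 y z s2 :
  wsum F (rcons s1 y ++ z :: s2) = wsum F (rcons s1 y) + F y z + wsum F (z :: s2).
Proof. by rewrite /wsum steps_cat big_cat big_cons /= addrA. Qed.

Lemma wsum_rev F s : (forall u v, F u v = F v u) -> wsum F (rev s) = wsum F s.
Proof.
move=> sF; rewrite /wsum steps_rev (perm_big (map (@swap T) (steps s))); last first.
  by rewrite perm_rev.
by rewrite big_map; apply: eq_bigr => q _; rewrite sF.
Qed.

Lemma wsum_rotation F a y z b : (forall u v, F u v = F v u) ->
  wsum F (rotation (rcons a y) (z :: b)) + F y z =
  wsum F (rcons a y ++ z :: b) + F y (last z b).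
Proof.
move=> sF; rewrite wsum_cat /rotation; have [b' E] := rev_cons_last z b.
rewrite E wsum_cat -E wsum_rev // -!addrA; congr (_ + _).
by rewrite addrCA [RHS]addrCA [F y z + _]addrC.
Qed.

End WSum.

(** * Rotations of an order with gaps *)

Section Gaps.
Variable V : finType.
Implicit Types (e : rel V) (s : seq V).

Definition gaps e s := count (fun q => ~~ e q.1 q.2) (steps s).

Lemma gaps_rotation e a y z b : symmetric e ->
  (gaps e (rotation (rcons a y) (z :: b)) + ~~ e y z =
   gaps e (rcons a y ++ z :: b) + ~~ e y (last z b))%N.
Proof. by move=> se; apply: (@count_rotation _ (fun u v => ~~ e u v)) => u v; rewrite se. Qed.

Lemma card_adj s z : uniq s -> (#|[set y | adj s z y]| <= 2)%N.
Proof.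
move=> us.
have h1 : (#|[set y | (z, y) \in steps s]| <= 1)%N.
  apply/card_le1_eqP => u v; rewrite !inE => hu hv.
  exact: unzip1_inj (uniq_unzip1_steps us) hv hu.
have h2 : (#|[set y | (y, z) \in steps s]| <= 1)%N.
  apply/card_le1_eqP => u v; rewrite !inE => hu hv.
  exact: unzip2_inj (uniq_unzip2_steps us) hv hu.
apply: leq_trans (leq_add h1 h2).
apply: leq_trans (leq_card_setU _ _); apply: subset_leq_card.
by apply/fintype.subsetP => y; rewrite !inE.
Qed.

Lemma leq_card_bigcup (I : finType) (P : {pred I}) (F : I -> {set V}) :
  (#|(\bigcup_(i in P) F i)%SET| <= \sum_(i in P) #|F i|)%N.
Proof.
apply: (big_ind2 (fun (A : {set V}) n => (#|A| <= n)%N)) => [|A m B n hA hB|//].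
  by rewrite cards0.
exact: leq_trans (leq_card_setU _ _) (leq_add hA hB).
Qed.

Lemma card_adj_set s (E A : {set V}) : uniq s ->
  (forall y, y \in A -> exists2 z, z \in E & adj s z y) -> (#|A| <= 2 * #|E|)%N.
Proof.
move=> us AE; apply: (@leq_trans #|(\bigcup_(z in E) [set y | adj s z y])%SET|).
  apply: subset_leq_card; apply/fintype.subsetP => y /AE[z zE zy].
  by apply/finset.bigcupP; exists z => //; rewrite inE.
apply: leq_trans (leq_card_bigcup _ _) _; rewrite mulnC -sum_nat_const.
by apply: leq_sum => z _; apply: card_adj.
Qed.

End Gaps.

(** * Posa's argument with the first vertex fixed: [e0] decides what is a gap, [e1] expands *)

Section Posa.
Variables (R : realType) (V : finType) (e0 e1 : rel V).
Hypotheses (sym0 : symmetric e0) (irr1 : irreflexive e1).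
Hypothesis (sub10 : subrel e1 e0).
Local Open Scope ring_scope.

(* Quantifying over all weights makes the property independent of the edge
   lengths and of the edges that may still be exposed. *)
Definition cheap (t : nat) (s s' : seq V) : Prop :=
  forall F : V -> V -> R, (forall u v, F u v = F v u) ->
    (forall u v, 0 <= F u v <= 1) -> wsum F s' <= wsum F s + t%:R.

Lemma cheap0 s : cheap 0 s s.
Proof. by move=> F _ _; rewrite addr0. Qed.

Lemma cheap_trans t1 t2 s1 s2 s3 :
  cheap t1 s1 s2 -> cheap t2 s2 s3 -> cheap (t1 + t2) s1 s3.
Proof.
move=> h1 h2 F sF bF; apply: le_trans (h2 F sF bF) _.
by rewrite natrD addrA lerD2r h1.
Qed.

Lemma cheap_le t1 t2 s s' : (t1 <= t2)%N -> cheap t1 s s' -> cheap t2 s s'.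
Proof.
by move=> h h1 F sF bF; apply: le_trans (h1 F sF bF) _; rewrite lerD2l ler_nat.
Qed.

Lemma cheap_rev t s s' : cheap t s s' -> cheap t s (rev s').
Proof. by move=> h F sF bF; rewrite wsum_rev //; apply: h. Qed.

Lemma cheap_rotation a y z b :
  cheap 1 (rcons a y ++ z :: b) (rotation (rcons a y) (z :: b)).
Proof.
move=> F sF bF; have E := wsum_rotation a y z b sF.
have /andP[h1 _] := bF y z; have /andP[_ h2] := bF y (last z b).
by lra.
Qed.

Variables (x : V) (p : seq V).
Hypothesis up : uniq (x :: p).
Hypothesis allp : forall y, y \in x :: p.

(* By the last clause, a vertex that is neither in [E] nor next to a member of [E]
   still has its two original neighbours; this drives Posa's argument. *)
Definition posa_state (E : {set V}) (t : nat) (w : V) (p' : seq V) : Prop :=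
  [/\ perm_eq p' p, last x p' = w,
      (gaps e0 (x :: p') <= gaps e0 (x :: p))%N,
      cheap t (x :: p) (x :: p') &
      forall u v, adj (x :: p) u v -> [\/ adj (x :: p') u v, u \in E | v \in E]].

Definition posa_inv (E : {set V}) (t : nat) : Prop :=
  forall w, w \in E -> exists p', posa_state E t w p'.

Lemma adj_two y : y != x -> y != last x p ->
  exists u v, [/\ u != v, adj (x :: p) u y & adj (x :: p) v y].
Proof.
move=> yx yl; have yp : y \in p by have := allp y; rewrite inE (negbTE yx).
case/splitPr: yp up yl => p1 [|v p2]; first by rewrite last_cat /= eqxx.
move=> u12 _; exists (last x p1), v; rewrite /adj.
have E : x :: p1 ++ y :: v :: p2 = (x :: p1) ++ y :: v :: p2 by [].
move: u12; rewrite E {E} lastI.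
rewrite steps_cat steps_cons2 !mem_cat !inE !eqxx !orbT; split=> //.
move: u12; rewrite cat_uniq => /and3P[_ /hasPn h _].
apply/eqP => uv; have := h v; rewrite !inE eqxx orbT => /(_ isT).
by rewrite mem_rcons inE uv eqxx.
Qed.

Lemma split_not_last y q : y \in q -> y != last x q ->
  exists a z b, q = rcons a y ++ z :: b.
Proof.
case/splitPr=> a [|z b]; first by rewrite last_cat /= eqxx.
by exists a, z, b; rewrite cat_rcons.
Qed.

(** Neither [y] nor an original neighbour of [y] lies in [E], so both original neighbours still
    flank [y] in [p'], and the successor [z] of [y] is one of them. Rotating with the edge from [w]
    to [y] makes [z] the last vertex; the new link is an edge, so no gap is added. *)
Lemma posa_pivot E t w p' y : posa_state E t w p' ->
  e1 w y -> y != x -> y != last x p -> y \notin E ->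
  (forall z, adj (x :: p) z y -> z \notin E) ->
  exists2 z, adj (x :: p) z y & forall E' : {set V}, E \subset E' -> z \in E' ->
    exists p'', posa_state E' t.+1 z p''.
Proof.
move=> [pp' lw gw cw aw] wy yx yl yE zE.
have [u [v [uv uy vy]]] := adj_two yx yl.
have yw : y != w by apply: contraTneq wy => ->; rewrite irr1.
have up' : uniq (x :: p') by rewrite (perm_uniq (_ : perm_eq _ (x :: p))) // perm_cons.
have yp' : y \in p' by rewrite (perm_mem pp'); have := allp y; rewrite inE (negbTE yx).
have [|a [z [b Ep']]] := split_not_last yp'; first by rewrite lw.
have Ep : x :: p' = rcons (x :: a) y ++ z :: b by rewrite Ep'.
have yz : (y, z) \in steps (x :: p') by apply/stepsP; exists (x :: a), b.
have keep c : adj (x :: p) c y -> adj (x :: p') c y.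
  by move=> cy; case: (aw _ _ cy) => // h; move: (zE _ cy) (yE); rewrite h.
have zuv : z = u \/ z = v.
  have [->|zu] := eqVneq z u; first by left.
  have [->|zv] := eqVneq z v; first by right.
  have h c : z != c -> adj (x :: p') c y -> (c, y) \in steps (x :: p').
    move=> zc /orP[//|yc]; case/eqP: zc.
    exact: unzip1_inj (uniq_unzip1_steps up') yz yc.
  case/eqP: uv.
  exact: unzip2_inj (uniq_unzip2_steps up') (h _ zu (keep _ uy)) (h _ zv (keep _ vy)).
exists z; first by case: zuv => ->.
move=> E' /fintype.subsetP EE' zE'; exists (rotation (rcons a y) (z :: b)).
have ER : x :: rotation (rcons a y) (z :: b) = rotation (rcons (x :: a) y) (z :: b) by [].
have lwb : last z b = w by rewrite -lw Ep' last_cat.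
split.
- by apply: perm_trans (perm_rotation _ _) _; rewrite -Ep'.
- by rewrite last_rotation.
- apply: leq_trans gw; rewrite ER Ep.
  have e0yw : e0 y w by rewrite sym0; apply: sub10.
  have := gaps_rotation (x :: a) y z b sym0.
  by rewrite [last z b]lwb e0yw /= addn0 => <-; apply: leq_addr.
- rewrite ER -addn1; apply: cheap_trans cw _; rewrite Ep; exact: cheap_rotation.
- move=> c d cd; case: (aw _ _ cd) => [|cE|dE]; last 2 first.
  + by apply: Or32; apply: EE'.
  + by apply: Or33; apply: EE'.
  rewrite Ep ER => /adj_rotation[h|->|->]; by [apply: Or31|apply: Or32|apply: Or33].
Qed.

Lemma posa_state_sub (E E' : {set V}) t t' w p' : E \subset E' -> (t <= t')%N ->
  posa_state E t w p' -> posa_state E' t' w p'.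
Proof.
move=> /fintype.subsetP sE tt' [h1 h2 h3 h4 h5]; split=> //; first exact: cheap_le h4.
by move=> u v /h5[?|/sE ?|/sE ?]; [apply: Or31|apply: Or32|apply: Or33].
Qed.

Definition neighbours (e : rel V) (S : {set V}) : {set V} :=
  [set y | (y \notin S) && [exists w in S, e w y]].

(** The factor 8 is what doubling the set of ends in [posa_step] consumes. The threshold 18 = 2 * (1
    + 8) keeps a small set together with fewer than 8 times as many neighbours inside half of the
    vertices, as the union bound for expansion requires. *)
Definition expander (e : rel V) := forall S : {set V},
  (18 * #|S| <= #|V|)%N -> (8 * #|S| <= #|neighbours e S|)%N.

Hypothesis exp1 : expander e1.

(** Of the 8|E| neighbours, at most 2|E| are adjacent in the order to [E], and the two ends of the
    order are at most 2|E| more. The remaining 4|E| are pivots, and since a vertex has at most two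
    neighbours in the order, a new end arises from at most two pivots. *)
Lemma posa_step E t : posa_inv E t -> (0 < #|E|)%N -> (18 * #|E| <= #|V|)%N ->
  exists E', posa_inv E' t.+1 /\ (2 * #|E| <= #|E'|)%N.
Proof.
move=> inv E0 /exp1 expE.
pose nb : {set V} := [set y | [exists z in E, adj (x :: p) z y]].
pose N := neighbours e1 E :\: (nb :|: [set x; last x p]).
have cN : (4 * #|E| <= #|N|)%N.
  have cnb : (#|nb| <= 2 * #|E|)%N.
    apply: (card_adj_set up) => y; rewrite inE => /existsP[z /andP[zE zy]].
    by exists z.
  have c2 : (#|[set x; last x p]| <= 2)%N by rewrite cards2; case: eqP.
  have c3 := leq_card_setU nb [set x; last x p].
  have c4 : (#|neighbours e1 E| <= #|N| + #|nb :|: [set x; last x p]|)%N.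
    rewrite -(cardsID (nb :|: [set x; last x p]) (neighbours e1 E)) addnC leq_add2l.
    by apply: subset_leq_card; apply: finset.subsetIr.
  have := leq_trans c4 (leq_add (leqnn _) c3); lia.
have /choice[f fP] : forall y, exists z, y \in N -> adj (x :: p) z y /\
    (forall E' : {set V}, E \subset E' -> z \in E' ->
     exists p'', posa_state E' t.+1 z p'').
  move=> y; have [|_] := boolP (y \in N); last by exists x.
  rewrite !inE !negb_or => /andP[/and3P[ynb yx yl]] /andP[yE] /existsP[w /andP[wE wy]].
  have [p' st] := inv _ wE.
  have [|z zy h] := posa_pivot st wy yx yl yE.
    by move=> z zy; apply: contra ynb => zE; apply/existsP; exists z; rewrite zE.
  by exists z.
exists (E :|: [set f y | y in N])%SET; split.
  move=> w; rewrite inE => /orP[wE|/imsetP[y yN ->]].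
    have [p' st] := inv _ wE; exists p'.
    by apply: posa_state_sub st => //; apply: finset.subsetUl.
  have [_ h] := fP _ yN; apply: h; first exact: finset.subsetUl.
  by rewrite inE; apply/orP; right; apply: imset_f.
have cf : (#|N| <= 2 * #|[set f y | y in N]|)%N.
  apply: (card_adj_set up) => y yN; exists (f y); first exact: imset_f.
  by have [] := fP _ yN.
apply: (@leq_trans #|[set f y | y in N]|); first by lia.
by apply: subset_leq_card; apply: finset.subsetUr.
Qed.

Lemma posa_grow k E t : posa_inv E t -> (0 < #|E|)%N -> (#|V| <= 2 ^ k * #|E|)%N ->
  exists2 E', posa_inv E' (t + k) & (#|V| < 18 * #|E'|)%N.
Proof.
elim: k E t => [|k IH] E t inv E0 h.
  by exists E; rewrite ?addn0 //; move: h; rewrite expn0; lia.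
have [hE|hE] := leqP (18 * #|E|) #|V|; last first.
  exists E => // w /inv[p' st]; exists p'.
  by apply: posa_state_sub st => //; apply: leq_addr.
have [E' [inv' c']] := posa_step inv E0 hE.
rewrite -addSnnS; apply: (IH E') => //; first by lia.
apply: leq_trans h _; rewrite expnS mulnAC mulnC; apply: leq_mul => //.
Qed.

(** At a gap any new link will do, because the link given up was not an edge. One rotation at each
    gap produces as many distinct ends as there are gaps; this head start reduces log n rotations to
    log(n/m). The last vertex is added so that [E] is nonempty even without gaps. *)
Lemma posa_init : exists E, [/\ posa_inv E 1, (0 < #|E|)%N & (gaps e0 (x :: p) <= #|E|)%N].
Proof.
pose E := (last x p |: [set z | has (fun q => ~~ e0 q.1 q.2 && (q.2 == z)) (steps (x :: p))])%SET.
exists E; split.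
- move=> w; rewrite !inE => /orP[/eqP->|/hasP[[y z] yz /= /andP[nyz /eqP <-]]].
    exists p; split=> //; first exact: cheap_le (cheap0 _).
    by move=> u v; apply: Or31.
  have zE : z \in E.
    by rewrite !inE; apply/orP; right; apply/hasP; exists (y, z); rewrite //= nyz eqxx.
  (* The gap may be the very first link, with [y] equal to the fixed vertex [x]; then all of [p] is
     reversed. *)
  have /stepsP[[|x' a] [b [Ex Ep]]] := yz.
    exists (rev (z :: b)); have Exb : x :: p = rcons [::] y ++ z :: b by rewrite Ex Ep.
    split.
    + by rewrite Ep perm_rev.
    + by rewrite rev_cons last_rcons.
    + have -> : x :: rev (z :: b) = rotation (rcons [::] y) (z :: b) by rewrite Ex.
      have := gaps_rotation [::] y z b sym0; rewrite nyz Exb; case: (~~ e0 y _) => /=; lia.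
    + have -> : x :: rev (z :: b) = rotation (rcons [::] y) (z :: b) by rewrite Ex.
      by rewrite Exb; apply: cheap_rotation.
    + have -> : x :: rev (z :: b) = rotation (rcons [::] y) (z :: b) by rewrite Ex.
      by move=> u v; rewrite Exb => /adj_rotation[h|->|->]; [apply: Or31|apply: Or32|apply: Or33].
  exists (rotation (rcons a y) (z :: b)).
  have Exp : x :: p = rcons (x :: a) y ++ z :: b by rewrite Ex Ep.
  have ER : x :: rotation (rcons a y) (z :: b) = rotation (rcons (x :: a) y) (z :: b) by [].
  split.
  + by rewrite Ep perm_rotation.
  + by rewrite last_rotation.
  + rewrite ER Exp; have := gaps_rotation (x :: a) y z b sym0.
    by rewrite nyz; case: (~~ e0 y _) => /=; lia.
  + by rewrite ER Exp; apply: cheap_rotation.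
  + by move=> u v; rewrite Exp ER => /adj_rotation[h|->|->]; [apply: Or31|apply: Or32|apply: Or33].
- by apply/card_gt0P; exists (last x p); rewrite !inE eqxx.
- rewrite /gaps -size_filter -(size_map snd).
  have u : uniq [seq q.2 | q <- steps (x :: p) & ~~ e0 q.1 q.2].
    apply: subseq_uniq (uniq_unzip2_steps up).
    by apply: map_subseq; apply: filter_subseq.
  rewrite -(card_uniqP u); apply: subset_leq_card; apply/fintype.subsetP => z /mapP[[y z'] /=].
  rewrite mem_filter /= => /andP[nyz yz] ->; rewrite !inE; apply/orP; right.
  by apply/hasP; exists (y, z'); rewrite //= nyz eqxx.
Qed.

Lemma posa_ends k : (#|V| <= 2 ^ k * maxn 1 (gaps e0 (x :: p)))%N ->
  exists2 E, posa_inv E k.+1 & (#|V| < 18 * #|E|)%N.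
Proof.
move=> h; have [E [inv E0 gE]] := posa_init.
rewrite -add1n; apply: (posa_grow inv E0).
by apply: leq_trans h _; rewrite leq_mul2l geq_max E0 gE orbT.
Qed.

End Posa.

(** * Rotations at both ends *)

Section Boosters.
Variables (R : realType) (V : finType) (e0 e1 : rel V).
Hypotheses (sym0 : symmetric e0) (irr1 : irreflexive e1).
Hypotheses (sub10 : subrel e1 e0) (exp1 : expander e1).

(** End pairs of cheap rearrangements of [s]: an edge on such a pair closes the rearranged order
    into a cyclic one without a gap at the seam. *)
Definition boosters (t : nat) (s : seq V) : {set V * V} :=
  [set q | `[< exists p', [/\ perm_eq (q.1 :: p') s, last q.1 p' = q.2,
     (gaps e0 (q.1 :: p') <= gaps e0 s)%N & cheap R t s (q.1 :: p')] >]].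

Lemma gaps_rev s : gaps e0 (rev s) = gaps e0 s.
Proof.
rewrite /gaps steps_rev count_rev count_map; apply: eq_count => q /=.
by rewrite sym0.
Qed.

Lemma card_set_prod (B : {set V * V}) : #|B| = (\sum_w #|[set v | (w, v) \in B]|)%N.
Proof.
rewrite -sum1_card big_mkcond /=.
rewrite (eq_bigr (fun q => if (q.1, q.2) \in B then 1%N else 0%N)); last by case.
rewrite -(pair_bigA _ (fun w v => if (w, v) \in B then 1%N else 0%N)) /=.
by apply: eq_bigr => w _; rewrite -big_mkcond -sum1dep_card.
Qed.

(** Rotations give n/18 possible last vertices [w]. Reversing makes [w] the fixed first vertex, and
    rotating again gives n/18 partners for each [w], hence the constant 324 = 18 * 18. *)
Lemma boosters_dichotomy k (s : seq V) : uniq s -> (forall v, v \in s) ->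
  (#|V| <= 2 ^ k * maxn 1 (gaps e0 s))%N ->
  (exists s', [/\ perm_eq s' s, (gaps e0 s' < gaps e0 s)%N & cheap R (k.+1 + k.+1) s s'])
  \/ (#|V| ^ 2 <= 324 * #|boosters (k.+1 + k.+1) s|)%N.
Proof.
move=> us als hk; case: (pselect (exists s', [/\ perm_eq s' s,
  (gaps e0 s' < gaps e0 s)%N & cheap R (k.+1 + k.+1) s s'])); first by left.
move=> nimp; right.
case: s us als hk nimp => [|x p] us als hk nimp.
  have : #|V| = 0%N by apply: eq_card0 => v; have := als v.
  by move=> ->.
have [E invE cE] := posa_ends R sym0 irr1 sub10 us als exp1 hk.
have row w : w \in E ->
    (#|V| <= 18 * #|[set v | (w, v) \in boosters (k.+1 + k.+1) (x :: p)]|)%N.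
  move=> /invE[p' [pp' lw gw cw _]].
  have [q Eq] := rev_cons_last x p'; rewrite lw in Eq.
  have pq : perm_eq (w :: q) (x :: p) by rewrite -Eq perm_rev perm_cons.
  have uq : uniq (w :: q) by rewrite (perm_uniq pq).
  have allq v : v \in w :: q by rewrite (perm_mem pq).
  have cq : cheap R k.+1 (x :: p) (w :: q) by rewrite -Eq; apply: cheap_rev.
  (* The second round needs as many gaps as the first to start from; losing one on the way is the
     other alternative. *)
  have gq : gaps e0 (w :: q) = gaps e0 (x :: p).
    apply/eqP; rewrite eqn_leq; apply/andP; split; first by rewrite -Eq gaps_rev.
    rewrite leqNgt; apply/negP => lt; apply: nimp; exists (w :: q); split=> //.
    by apply: cheap_le cq; apply: leq_addr.
  have hk' : (#|V| <= 2 ^ k * maxn 1 (gaps e0 (w :: q)))%N by rewrite gq.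
  have [E2 inv2 c2] := posa_ends R sym0 irr1 sub10 uq allq exp1 hk'.
  apply: leq_trans (ltnW c2) _; rewrite leq_mul2l; apply/orP; right.
  apply: subset_leq_card; apply/fintype.subsetP => v /inv2[q' [pq' lq' gq' cq' _]].
  rewrite !inE; exists q' => /=; split=> //.
  - by rewrite (perm_trans _ pq) // perm_cons.
  - by rewrite -gq.
  - exact: (cheap_trans cq cq').
rewrite card_set_prod.
apply: (@leq_trans (18 * \sum_(w in E) #|V|)); last first.
  rewrite -[324%N]/(18 * 18)%N -mulnA leq_mul2l /= big_distrr /=.
  rewrite [leqRHS](bigID (mem E)) /=; apply: leq_trans (leq_addr _ _).
  by apply: leq_sum => w /row.
by rewrite sum_nat_const mulnA -mulnn leq_mul2r (ltnW cE) orbT.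
Qed.

End Boosters.

(** * Merging paths inside cells *)

Section DFS.
Variables (T : eqType) (link : rel T).

(* [P] is the current stack, top first, [S] the finished objects and [U] the
   unvisited ones; [2 * size U + size P] decreases. *)
Lemma dfs_run m P S U : (2 * size U + size P <= m)%N ->
  sorted link (rev P) -> {in S & U, forall b c, ~~ link b c} ->
  (size S <= size U)%N ->
  exists P' S' U', [/\ perm_eq (P' ++ S' ++ U') (P ++ S ++ U), sorted link (rev P'),
    {in S' & U', forall b c, ~~ link b c} & size S' = size U'].
Proof.
elim: m P S U => [|m IH] P S U hm sP nSU hSU.
  by exists P, S, U; split=> //; case: U hm hSU {nSU} => // hm; case: S.
have [eSU|neSU] := eqVneq (size S) (size U); first by exists P, S, U.
have ltSU : (size S < size U)%N by rewrite ltn_neqAle neSU.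
case: P hm sP => [|b P] hm sP.
  case: U hm nSU hSU neSU ltSU => [|c U] hm nSU hSU neSU ltSU //.
  have [| |b d bS dU||P' [S' [U' [pe s n z]]]] := IH [:: c] S U => //.
  - by move: hm => /=; lia.
  - by apply: nSU => //; rewrite inE dU orbT.
  exists P', S', U'; split=> //; apply: perm_trans pe _.
  by apply/permP => a; do 3! rewrite /= ?count_cat; lia.
have [/hasP[c cU bc]|/hasPn nb] := boolP (has (link b) U).
  have sU : size U = (size (rem c U)).+1 by rewrite size_rem //; case: (U) cU.
  have [| |b' d b'S dU||P' [S' [U' [pe s n z]]]] := IH (c :: b :: P) S (rem c U) => //.
  - by move: hm; rewrite sU /=; lia.
  - move: sP; rewrite !rev_sorted /= => ->; by rewrite andbT.
  - by apply: nSU => //; apply: mem_rem dU.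
  - by move: ltSU; rewrite sU ltnS.
  exists P', S', U'; split=> //; apply: perm_trans pe _.
  have pU : perm_eq U (c :: rem c U) by apply: perm_to_rem.
  rewrite perm_sym; apply: (@perm_trans _ ((b :: P) ++ S ++ c :: rem c U)).
    by rewrite perm_cat2l perm_cat2l.
  by apply/permP => a; do 3! rewrite /= ?count_cat; lia.
have [| |b' d b'S dU||P' [S' [U' [pe s n z]]]] := IH P (b :: S) U => //.
- by move: hm => /=; lia.
- by move: sP; rewrite !rev_sorted /= => /path_sorted.
- by move: b'S; rewrite inE => /orP[/eqP->|b'S]; [apply: nb|apply: nSU].
exists P', S', U'; split=> //; apply: perm_trans pe _.
by apply/permP => a; do 3! rewrite /= ?count_cat; lia.
Qed.

(** Every move of the search lowers the excess of unvisited over finished objects by exactly one, so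
    it can be stopped when the two are equally many. *)
Lemma dfs os : exists P S U, [/\ perm_eq (P ++ S ++ U) os, sorted link P,
    {in S & U, forall b c, ~~ link b c} & size S = size U].
Proof.
have [||//|P [S [U [pe s n z]]]] := @dfs_run _ [::] [::] os (leqnn _) => //.
exists (rev P), S, U; split=> //; apply: perm_trans pe.
by rewrite perm_cat2r perm_rev.
Qed.

End DFS.

Section Blocks.
Variables (R : realType) (V : finType) (e : rel V).
Implicit Types (b : seq V) (bs : seq (seq V)).
Local Open Scope ring_scope.

Definition block b := (b != [::]) && sorted e b.

Definition cost (F : V -> V -> R) bs : R := \sum_(b <- bs) wsum F b.

Lemma wsum_flatten (F : V -> V -> R) (delta : R) Q :
  (forall u v, u \in flatten Q -> v \in flatten Q -> F u v <= delta) -> 0 <= delta ->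
  all (fun b => b != [::]) Q ->
  wsum F (flatten Q) <= cost F Q + delta *+ (size Q).-1.
Proof.
rewrite /cost; elim: Q => [|b [|c Q] IH] hF d0.
- by rewrite /= wsum_nil big_nil addr0.
- by rewrite /= cats0 big_seq1 mulr0n addr0.
case/lastP: b hF => // b y hF; case: c IH hF => [|z c] IH hF aQ; first by rewrite /= andbF in aQ.
have {}IH : wsum F (flatten ((z :: c) :: Q)) <=
    \sum_(b <- (z :: c) :: Q) wsum F b + delta *+ size Q.
  apply: IH => //; last by move: aQ => /= /andP[].
  by move=> u v uQ vQ; apply: hF; rewrite -[flatten _]/(rcons b y ++ _) mem_cat ?uQ ?vQ orbT.
have h : F y z <= delta.
  by apply: hF; rewrite /= mem_cat ?mem_rcons ?inE eqxx ?orbT.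
rewrite -[flatten (rcons b y :: _)]/(rcons b y ++ z :: (c ++ flatten Q)) wsum_cat.
rewrite [in leRHS]big_cons -[size _]/(size Q).+2 mulrSr; move: IH => /=.
by move: (\sum_(_ <- _) _) (delta *+ _) => M N h'; lra.
Qed.

Lemma sorted_flatten (x0 : V) Q :
  all block Q -> sorted (fun b c => e (last x0 b) (head x0 c)) Q -> sorted e (flatten Q).
Proof.
elim: Q => [|b [|c Q] IH] //=; first by rewrite cats0 andbT => /andP[].
move=> /andP[/andP[b0 sb] cQ] /andP[lbc sQ].
have := IH cQ sQ; case/lastP: b b0 sb lbc => // b y _; rewrite last_rcons.
case: c {IH sQ} cQ => // z c _ sb lbc /= sc.
rewrite cat_rcons; case: b sb => [|a b] /=; first by rewrite lbc.
by rewrite rcons_path cat_path /= => /andP[-> ->]; rewrite lbc.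
Qed.

Lemma mem_flatten_block bs b v : b \in bs -> v \in b -> v \in flatten bs.
Proof. by move=> bb vb; apply/flattenP; exists b. Qed.

Lemma uniq_ends (f : seq V -> V) bs : uniq (flatten bs) ->
  (forall b, b \in bs -> f b \in b) -> uniq (map f bs).
Proof.
elim: bs => [|b bs IH] //=; rewrite cat_uniq => /and3P[_ /hasPn h ub] hf.
rewrite IH // ?andbT; last by move=> c cb; apply: hf; rewrite inE cb orbT.
apply/mapP => -[c cb E]; have /h : f b \in flatten bs.
  by rewrite E; apply: (mem_flatten_block cb); apply: hf; rewrite inE cb orbT.
by rewrite /= hf // mem_head.
Qed.

(** Depth-first search on blocks, where [b] links to [c] if an edge leads from the last vertex of
    [b] to the first of [c]. The stack becomes a single block; the finished and the unvisited blocks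
    stay, and they are witnessed by the last vertices [S] of the former and the first vertices [U]
    of the latter. *)
Lemma merge_cell (F : V -> V -> R) (delta : R) bs :
  uniq (flatten bs) -> all block bs -> 0 <= delta ->
  (forall u v, u \in flatten bs -> v \in flatten bs -> F u v <= delta) ->
  exists bs' (S U : {set V}), [/\ perm_eq (flatten bs') (flatten bs), all block bs',
    cost F bs' <= cost F bs + delta *+ size bs, (size bs' <= 2 * #|S| + 1)%N &
    [/\ #|S| = #|U|, [disjoint S & U], {subset S <= flatten bs}, {subset U <= flatten bs} &
     {in S & U, forall x y, ~~ e x y}]].
Proof.
case: bs => [|[|x0 b0] bs0] ufl //.
  move=> _ d0 _; exists [::], finset.set0, finset.set0; split; rewrite ?cards0 ?addr0 //.
  split=> //; first by apply/pred0P => x; rewrite /= !inE.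
  - by move=> x; rewrite finset.in_set0.
  - by move=> x; rewrite finset.in_set0.
  - by move=> x y; rewrite finset.in_set0.
set bs := _ :: bs0 in ufl *; move=> allb d0 hF.
have [P [S [U [pe sP nSU sSU]]]] := dfs (fun b c => e (last x0 b) (head x0 c)) bs.
have pf : perm_eq (flatten P ++ flatten S ++ flatten U) (flatten bs).
  by rewrite -!flatten_cat; apply: perm_flatten.
have aPSU : all block (P ++ S ++ U) by rewrite (perm_all _ pe).
move: (aPSU); rewrite !all_cat => /and3P[aP aS aU].
have uPSU : uniq (flatten P ++ flatten S ++ flatten U) by rewrite (perm_uniq pf).
have subf v : (v \in flatten P) || (v \in flatten S) || (v \in flatten U) -> v \in flatten bs.
  by rewrite -(perm_mem pf) !mem_cat orbA.
have lastin b : block b -> last x0 b \in b.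
  by case: b => // a b _; rewrite /= mem_last.
have headin b : block b -> head x0 b \in b.
  by case: b => // a b _; rewrite /= mem_head.
have sfP := sorted_flatten aP sP.
have wfP : wsum F (flatten P) <= cost F P + delta *+ size P.
  apply: (@le_trans _ _ (cost F P + delta *+ (size P).-1)).
    apply: wsum_flatten => //; last by apply: sub_all aP => b /andP[].
    by move=> u v uP vP; apply: hF; apply: subf; rewrite ?uP ?vP.
  by rewrite lerD2l -(mulr_natr _ (size P)) -(mulr_natr _ (size P).-1) ler_wpM2l // ler_nat leq_pred.
(* An empty stack must contribute no block at all, as blocks are nonempty. *)
pose top := if P is [::] then [::] else [:: flatten P].
have ftop : flatten top = flatten P by rewrite /top; case: (P) => //= *; rewrite cats0.
have costP : cost F bs = cost F P + cost F S + cost F U.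
  by rewrite /cost -(perm_big _ pe) !big_cat /= addrA.
have ctop : cost F top <= cost F P + delta *+ size P.
  rewrite /top; case EP: P => [|b Q].
    by rewrite /cost !big_nil addr0.
  by rewrite -EP /cost big_seq1.
have szP : (size P <= size bs)%N by rewrite -(perm_size pe) size_cat leq_addr.
pose A := [set x in map (last x0) S]%SET; pose B := [set x in map (head x0) U]%SET.
have uS : uniq (map (last x0) S).
  apply: uniq_ends; first by move: uPSU; rewrite !cat_uniq => /and3P[_ _ /and3P[]].
  by move=> b bS; apply: lastin; exact: (allP aS _ bS).
have uU : uniq (map (head x0) U).
  apply: uniq_ends; first by move: uPSU; rewrite !cat_uniq => /and3P[_ _ /and3P[]].
  by move=> b bU; apply: headin; exact: (allP aU _ bU).
have cA : #|A| = size S by rewrite cardsE (card_uniqP uS) size_map.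
have cB : #|B| = size U by rewrite cardsE (card_uniqP uU) size_map.
have memA v : v \in A -> v \in flatten S.
  rewrite inE => /mapP[b bS ->]; apply: (mem_flatten_block bS); apply: lastin; exact: (allP aS _ bS).
have memB v : v \in B -> v \in flatten U.
  rewrite inE => /mapP[b bU ->]; apply: (mem_flatten_block bU); apply: headin; exact: (allP aU _ bU).
exists (top ++ S ++ U), A, B; split.
- by rewrite !flatten_cat ftop.
- rewrite !all_cat aS aU !andbT /top; case EP: P => [|b Q] //; rewrite -EP /= /block sfP !andbT.
  by move: aP; rewrite EP /= => /andP[/andP[]]; case: (b).
- rewrite costP [cost F (top ++ _)]/cost !big_cat /= -/(cost F top) -/(cost F S) -/(cost F U).
  have : delta *+ size P <= delta *+ size bs by rewrite -(mulr_natr _ (size P)) -(mulr_natr _ (size bs)) ler_wpM2l // ler_nat.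
  move: ctop; move: (delta *+ size P) (delta *+ size bs) => dP db h1 h2; lra.
- by rewrite !size_cat cA -sSU addnC mul2n -addnn leq_add2l /top; case: (P).
split.
- by rewrite cA cB.
- apply/pred0P => v /=; apply/negP => /andP[vA vB].
  move: uPSU; rewrite !cat_uniq => /and3P[_ _ /and3P[_ /hasPn h _]].
  by have := h _ (memB _ vB); rewrite /= memA.
- by move=> v /memA vS; apply: subf; rewrite vS orbT.
- by move=> v /memB vS; apply: subf; rewrite vS orbT.
- move=> u v; rewrite !inE => /mapP[b bS ->] /mapP[c cU ->]; exact: nSU.
Qed.

(** The condition of equal counts makes the number of pairs inside cells a sum of squares, which is
    bounded below through the number of cells. *)
Definition linked_cells (C : finType) (kappa : V -> C) (u : R) :=
  forall S U : {set V}, [disjoint S & U] ->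
    (forall c, #|[set x in S | kappa x == c]| = #|[set x in U | kappa x == c]|) ->
    (forall x y, x \in S -> y \in U -> kappa x = kappa y -> ~~ e x y) -> #|S|%:R <= u.

Definition constant_blocks (C : eqType) (kappa : V -> C) bs :=
  forall b, b \in bs -> {in b &, forall x y, kappa x = kappa y}.

(** The left-over sets of all cells are united before [linked_cells] is applied: one cell alone may
    hold too few vertices for any bound, only the total is controlled. The term #|C| is the one
    merged block per cell. *)
Lemma merge_level (C : finType) (kappa : V -> C) (F : V -> V -> R) (delta u : R) bs :
  perm_eq (flatten bs) (enum V) -> all block bs -> constant_blocks kappa bs ->
  0 <= delta -> (forall x y, kappa x = kappa y -> F x y <= delta) ->
  linked_cells kappa u ->
  exists bs', [/\ perm_eq (flatten bs') (enum V), all block bs', constant_blocks kappa bs',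
    cost F bs' <= cost F bs + delta *+ size bs & (size bs')%:R <= 2 * u + #|C|%:R].
Proof.
move=> pbs abs cbs d0 hF lc.
have [x0 _|V0] := fintype.pickP (predT : pred V); last first.
  exists [::]; have e0 : enum V = [::] by apply/eqP; rewrite -size_eq0 -cardE; apply/eqP/eq_card0.
  split; rewrite ?e0 // /cost ?big_nil //.
  - rewrite addr_ge0 ?mulrn_wge0 // sumr_ge0 // => b _.
    rewrite /wsum big_seq sumr_ge0 // => -[y z] _; have := V0 y; by [].
  - rewrite addr_ge0 // mulr_ge0 //.
    have := lc finset.set0 finset.set0; rewrite cards0; apply.
    + by apply/pred0P => x; rewrite /= !inE.
    + by move=> c; congr #|_|.
    + by move=> x y; rewrite finset.in_set0.
(* A block lies in one cell, so its first vertex decides which; the default [x0] is never reached,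
   since blocks are nonempty. *)
pose cell c := [seq b <- bs | kappa (head x0 b) == c].
have ufl : uniq (flatten bs) by rewrite (perm_uniq pbs) enum_uniq.
have kcell c v : v \in flatten (cell c) -> kappa v = c.
  case/flattenP=> b; rewrite mem_filter => /andP[/eqP<- bb] vb.
  apply: (cbs _ bb) => //; have /andP[] := allP abs _ bb.
  by case: (b) => // a b' _ _; rewrite /= mem_head.
have ucell c : uniq (flatten (cell c)).
  rewrite /cell; elim: (bs) ufl => [|b l IH] //=; rewrite cat_uniq => /and3P[ub /hasPn h ul].
  case: ifP => _ //=; rewrite ?cat_uniq ?ub ?IH //= andbT; apply/hasPn => v /flattenP[b'].
  rewrite mem_filter => /andP[_ b'l] vb'; apply: h; exact: mem_flatten_block b'l vb'.
have acell c : all block (cell c) by apply/allP => b; rewrite mem_filter => /andP[_ /(allP abs)].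
have /choice[f fP] : forall c, exists r : seq (seq V) * ({set V} * {set V}),
  [/\ perm_eq (flatten r.1) (flatten (cell c)), all block r.1,
    cost F r.1 <= cost F (cell c) + delta *+ size (cell c), (size r.1 <= 2 * #|r.2.1| + 1)%N &
    [/\ #|r.2.1| = #|r.2.2|, [disjoint r.2.1 & r.2.2], {subset r.2.1 <= flatten (cell c)},
     {subset r.2.2 <= flatten (cell c)} & {in r.2.1 & r.2.2, forall x y, ~~ e x y}]].
  move=> c; have [|bs' [S [U h]]] := @merge_cell F delta (cell c) (ucell c) (acell c) d0.
    by move=> x y /kcell kx /kcell ky; apply: hF; rewrite kx ky.
  by exists (bs', (S, U)).
have split_sum (M : nmodType) (g : seq V -> M) :
    \sum_(b <- bs) g b = \sum_c \sum_(b <- cell c) g b.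
  rewrite (eq_bigr (fun c => \sum_(b <- bs | kappa (head x0 b) == c) g b)); last first.
    by move=> c _; rewrite big_filter.
  rewrite (exchange_big_dep predT) //=; apply: eq_bigr => b _.
  by rewrite (big_pred1 (kappa (head x0 b))) // => i; rewrite /= eq_sym.
pose bs' := flatten [seq (f c).1 | c <- enum C].
have sum' (M : nmodType) (g : seq V -> M) :
    \sum_(b <- bs') g b = \sum_c \sum_(b <- (f c).1) g b.
  by rewrite /bs' big_flatten big_map big_enum.
have cntE a l : count a (flatten l) = \sum_(b <- l) count a b :> nat.
  by rewrite count_flatten sumnE big_map.
have mem' b : b \in bs' -> exists2 c, b \in (f c).1 & true.
  by case/flattenP=> l /mapP[c _ ->] bc; exists c.
exists bs'; split.
- apply: perm_trans pbs; apply/permP => a; rewrite !cntE split_sum sum'.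
  apply: eq_bigr => c _; rewrite -!cntE; have [/permP -> //] := fP c.
- by apply/allP => b /mem'[c bc _]; have [_ /allP h _ _ _] := fP c; apply: h.
- move=> b /mem'[c bc _] x y xb yb; have [/perm_mem pc _ _ _ _] := fP c.
  have kf v : v \in b -> kappa v = c.
    by move=> vb; apply: kcell; rewrite -pc; apply: mem_flatten_block vb.
  by rewrite !kf.
- rewrite /cost sum' split_sum -sum1_size -sumrMnr.
  have -> : \sum_(i <- bs) delta *+ 1 = \sum_c delta *+ size (cell c).
    by rewrite split_sum; apply: eq_bigr => c _; rewrite sumrMnr sum1_size.
  rewrite -big_split /=; apply: ler_sum => c _; by have [] := fP c.
pose S := [set x | x \in (f (kappa x)).2.1]%SET; pose U := [set x | x \in (f (kappa x)).2.2]%SET.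
have kS c x : x \in (f c).2.1 -> kappa x = c.
  by have [_ _ _ _ [_ _ h _ _]] := fP c => /h /kcell.
have kU c x : x \in (f c).2.2 -> kappa x = c.
  by have [_ _ _ _ [_ _ _ h _]] := fP c => /h /kcell.
have SE c : [set x in S | kappa x == c]%SET = (f c).2.1.
  apply/finset.setP => x; rewrite !inE; apply/andP/idP => [[h /eqP E]|h].
    by rewrite -E.
  by rewrite (kS _ _ h) eqxx h.
have UE c : [set x in U | kappa x == c]%SET = (f c).2.2.
  apply/finset.setP => x; rewrite !inE; apply/andP/idP => [[h /eqP E]|h].
    by rewrite -E.
  by rewrite (kU _ _ h) eqxx h.
have cS : #|S| = (\sum_c #|(f c).2.1|)%N.
  rewrite -sum1_card (partition_big kappa predT) //=; apply: eq_bigr => c _.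
  by rewrite -SE -sum1dep_card; apply: eq_bigl => x; rewrite !inE.
have hu : #|S|%:R <= u.
  apply: (lc S U).
  - apply/pred0P => x; apply/negP => /=; rewrite !inE => /andP[xS xU].
    have [_ _ _ _ [_ dj _ _ _]] := fP (kappa x).
    by have := disjointFr dj xS; rewrite xU.
  - by move=> c; rewrite SE UE; have [_ _ _ _ []] := fP c.
  - move=> x y; rewrite !inE => xS yU kxy; have [_ _ _ _ [_ _ _ _ h]] := fP (kappa x).
    by apply: h => //; rewrite kxy.
have hsz : (size bs' <= 2 * #|S| + #|C|)%N.
  rewrite -sum1_size sum' cS big_distrr /= -sum1_card -big_split /=.
  apply: leq_sum => c _; rewrite sum1_size; by have [] := fP c.
have := hsz; rewrite -(ler_nat R) natrD natrM => h; lra.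
Qed.

End Blocks.

(** * From few paths to a Hamilton cycle *)

Lemma steps_cat_cons (T : Type) (x : T) p q :
  steps (x :: p ++ q) = steps (x :: p) ++ steps (last x p :: q).
Proof. by elim: p x => [|y p IH] x //=; congr (_ :: _); apply: IH. Qed.

Section Cyclic.
Variable T : eqType.
Implicit Types s p : seq T.

Definition csteps s : seq (T * T) := if s is x :: p then steps (x :: rcons p x) else [::].

Lemma csteps_cons x p : csteps (x :: p) = rcons (steps (x :: p)) (last x p, x).
Proof. by rewrite /csteps -cats1 steps_cat_cons cats1. Qed.

Lemma csteps_split s y z : (y, z) \in csteps s ->
  exists p, [/\ perm_eq (z :: p) s, last z p = y & perm_eq (csteps (z :: p)) (csteps s)].
Proof.
have count_cons P c (l : seq (T * T)) : count P (c :: l) = (P c + count P l)%N by [].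
have count_nil P : count P ([::] : seq (T * T)) = 0%N by [].
case: s => [|x p] //; rewrite csteps_cons mem_rcons inE => /orP[/eqP[-> ->]|].
  by exists p; rewrite csteps_cons; split.
case/stepsP=> [[|x' a] [b [-> ->]]].
  exists (b ++ [:: y]); split; rewrite ?last_cat //; first by rewrite -cat_cons perm_catC.
  rewrite !csteps_cons last_cat -!cats1 steps_cat_cons.
  have s1 c : steps [:: c] = [::] :> seq (T * T) by [].
  by apply/permP => P; rewrite !steps_cons2 !s1 /= !(count_cat, count_cons, count_nil); lia.
exists (b ++ x' :: rcons a y); split.
- by rewrite -cat_cons perm_catC.
- by rewrite last_cat /= last_rcons.
rewrite !csteps_cons last_cat /= !last_rcons !last_cat /= steps_cat_cons -!cats1.
rewrite [steps (x' :: (_ ++ _) ++ _)]steps_cat_cons last_cat /=.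
have E c (l : seq T) : steps [:: c, z & l] = (c, z) :: steps (z :: l) by [].
have E' c (l : seq T) : steps [:: c, x' & l] = (c, x') :: steps (x' :: l) by [].
rewrite E E'; apply/permP => P; rewrite !(count_cat, count_cons, count_nil); ring.
Qed.

End Cyclic.

(** * Closing one gap of a cyclic order *)

Section CyclicWeights.
Variables (R : realType) (V : finType).
Implicit Types (e : rel V) (s p : seq V).
Local Open Scope ring_scope.

Definition cgaps e s := count (fun q => ~~ e q.1 q.2) (csteps s).
Definition cwsum (F : V -> V -> R) s := \sum_(q <- csteps s) F q.1 q.2.

Lemma cgaps_cons e x p : cgaps e (x :: p) = (gaps e (x :: p) + ~~ e (last x p) x)%N.
Proof. by rewrite /cgaps csteps_cons -cats1 count_cat /= addn0. Qed.

Lemma cwsum_cons F x p : cwsum F (x :: p) = wsum F (x :: p) + F (last x p) x.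
Proof. by rewrite /cwsum csteps_cons -cats1 big_cat big_seq1. Qed.

(** Cutting a cyclic order at a gap hides that gap at the seam; joining the ends after rotations is
    then what removes it. *)
Lemma open_at_gap e s : (0 < cgaps e s)%N ->
  exists x p, [/\ perm_eq (x :: p) s, ~~ e (last x p) x, gaps e (x :: p) = (cgaps e s).-1 &
    forall F, cwsum F (x :: p) = cwsum F s].
Proof.
rewrite -has_count => /hasP[[y z] /csteps_split[p [ps lp cp]] /= nyz].
exists z, p; rewrite lp; split=> //.
  have := cgaps_cons e z p; rewrite lp nyz addn1 {1}/cgaps (permP cp) -/(cgaps _ _).
  by move=> ->.
by move=> F; apply: perm_big.
Qed.

Definition kept (s : seq V) (D : {set V}) : rel V := fun u v =>
  (((u, v) \in steps s) && (u \in D)) || (((v, u) \in steps s) && (v \in D)).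

Definition addrel (e f : rel V) : rel V := fun u v => e u v || f u v.

(* [D] records which links of [s] are edges, so that the boosters depend on [e1], [s]
   and [D] only, and a union bound over [s], [D] and [k] controls [hits e1 e2] for an
   [e2] exposed after [e1]. *)
Definition hits (e1 e2 : rel V) := forall s (D : {set V}) k,
  uniq s -> (forall v, v \in s) -> (k <= 2 * #|V| + 2)%N ->
  let B := boosters R (addrel e1 (kept s D)) (k.+1 + k.+1) s in
  (#|V| ^ 2 <= 324 * #|B|)%N -> exists2 q, q \in B & e2 q.1 q.2.

Variables (e1 e2 : rel V).
Hypotheses (sym1 : symmetric e1) (sym2 : symmetric e2) (irr1 : irreflexive e1).
Hypotheses (exp1 : expander e1) (hit12 : hits e1 e2).
Local Notation e := (addrel e1 e2).

Lemma order_perm s : perm_eq s (enum V) -> uniq s /\ (forall v, v \in s).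
Proof.
move=> ps; split; first by rewrite (perm_uniq ps) enum_uniq.
by move=> v; rewrite (perm_mem ps) mem_enum.
Qed.

(** Rotations run in [e0], the graph [e1] plus those links of the current order that are edges. On
    this order it has the same gaps as the full graph, but it depends on [e2] only through [D], so
    [hits] applies. *)
Lemma merge_gap k s : perm_eq s (enum V) -> (0 < cgaps e s)%N -> (k <= 2 * #|V| + 2)%N ->
  (#|V| <= 2 ^ k * maxn 1 (cgaps e s).-1)%N ->
  exists s', [/\ perm_eq s' (enum V), (cgaps e s' < cgaps e s)%N &
    forall F : V -> V -> R, (forall u v, F u v = F v u) -> (forall u v, 0 <= F u v <= 1) ->
      cwsum F s' <= cwsum F s + (2 * k + 3)%:R].
Proof.
move=> ps gs hk hV; have [x [p [pxp cl gxp cw]]] := open_at_gap gs.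
have pV : perm_eq (x :: p) (enum V) := perm_trans pxp ps.
have [up allp] := order_perm pV.
(* Links of a repetition-free order have distinct first vertices, so a set of vertices can name any
   set of links. *)
pose D := [set u | has (fun q => (q.1 == u) && e q.1 q.2) (steps (x :: p))]%SET.
pose e0 := addrel e1 (kept (x :: p) D).
have syme u v : e u v = e v u by rewrite /addrel sym1 sym2.
have inD u v : (u, v) \in steps (x :: p) -> (u \in D) = e u v.
  move=> uv; rewrite inE; apply/hasP/idP => [[[u' v'] uv' /= /andP[/eqP E]]|euv]; last first.
    by exists (u, v); rewrite //= eqxx.
  by subst u'; rewrite (unzip1_inj (uniq_unzip1_steps up) uv uv').
have sub0e u v : e0 u v -> e u v.
  case/orP=> [h|]; first by rewrite /addrel h.
  by case/orP=> /andP[h]; rewrite (inD _ _ h) // syme.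
have sub10 : subrel e1 e0 by move=> u v h; rewrite /e0 /addrel h.
have sym0 : symmetric e0.
  by move=> u v; rewrite /e0 /addrel /kept sym1; congr (_ || _); rewrite orbC.
have g0 : gaps e0 (x :: p) = (cgaps e s).-1.
  rewrite -gxp; apply: eq_in_count => -[u v] uv /=; congr (~~ _).
  apply/idP/idP; first exact: sub0e.
  by move=> euv; rewrite /e0 /addrel /kept uv (inD _ _ uv) euv orbT.
have gle s' : (gaps e s' <= gaps e0 s')%N.
  by apply: sub_count => q; apply: contra; apply: sub0e.
have wle s' (F : V -> V -> R) : (forall u v, 0 <= F u v <= 1) ->
    cheap R (k.+1 + k.+1) (x :: p) s' -> (forall u v, F u v = F v u) ->
    cwsum F s' <= cwsum F s + (2 * k + 3)%:R.
  move=> bF c sF; case: s' c => [|y q] c.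
    rewrite /cwsum big_nil addr_ge0 // sumr_ge0 // => -[a b] _; by case/andP: (bF a b).
  have := c F sF bF; rewrite cwsum_cons -(cw F) cwsum_cons.
  have /andP[h1 h2] := bF (last y q) y; have /andP[h3 h4] := bF (last x p) x.
  (* k + 1 rotations on each side, and one closing link. *)
  have -> : (2 * k + 3)%:R = (k.+1 + k.+1)%:R + 1 :> R.
    by rewrite natr1; congr _%:R; lia.
  lra.
have hV0 : (#|V| <= 2 ^ k * maxn 1 (gaps e0 (x :: p)))%N by rewrite g0.
case: (boosters_dichotomy R sym0 irr1 sub10 exp1 up allp hV0).
  case=> s' [ps' gs' cs']; exists s'; split.
  - exact: perm_trans ps' pV.
  - case: s' {cs'} ps' gs' => [|y q] _ gs' //.
    have := gle (y :: q); move: gs'; rewrite cgaps_cons g0.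
    case: (~~ e _ _) => /=; lia.
  - by move=> F sF bF; apply: wle.
move=> /(hit12 up allp hk)[[w v] wB /= e2wv].
move: wB; rewrite !inE /= => -[p' [pp' lp' gp' cp']].
exists (w :: p'); split.
- exact: perm_trans pp' pV.
- rewrite cgaps_cons lp' /addrel sym2 e2wv orbT /= addn0.
  apply: leq_ltn_trans (gle _) _; apply: leq_ltn_trans gp' _.
  by rewrite -/e0 g0 ltn_predL.
- by move=> F sF bF; apply: wle.
Qed.

End CyclicWeights.

(** * Summing the costs of both stages *)

Section Tour.
Variables (R : realType) (V : finType).
Implicit Types (s : seq V) (F : V -> V -> R).
Local Open Scope ring_scope.

(** Trades the linear factor coming from the logarithm for a change of base from 3 to 2. *)
Lemma le_two_expr32 i : i.+1%:R <= 2 * (3 / 2) ^+ i :> R.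
Proof.
elim: i => [|i IH]; first by rewrite expr0; lra.
have h : 1 <= (3 / 2) ^+ i :> R by rewrite exprn_ege1 //; lra.
by rewrite exprS -natr1; lra.
Qed.

Lemma ratio_expr (i : nat) : (3 / 2) ^+ i / 3 ^+ i = (2 ^+ i)^-1 :> R.
Proof. by rewrite -expr_div_n -exprVn; congr (_ ^+ _); field. Qed.

Lemma expr2_le_expr3 (i : nat) : (3 ^+ i)^-1 <= (2 ^+ i)^-1 :> R.
Proof.
by rewrite lef_pV2 ?posrE ?exprn_gt0 ?ltr0n // lerXn2r ?nnegrE //; lra.
Qed.

Variables (e1 e2 : rel V).
Hypotheses (sym1 : symmetric e1) (sym2 : symmetric e2) (irr1 : irreflexive e1).
Hypotheses (exp1 : expander e1) (hit12 : hits R e1 e2).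
Local Notation e := (addrel e1 e2).
Local Notation n := #|V|.

Definition normal_weight F :=
  (forall u v, F u v = F v u) /\ (forall u v, 0 <= F u v <= 1).

(** Phase i covers gap numbers between 3n/3^(i+1) and 3n/3^i, so one rotation depth serves for the
    whole phase; [m] bounds the number of merges left. *)
Lemma merge_phase i m s : perm_eq s (enum V) -> (cgaps e s <= m)%N ->
  (m * 3 ^ i <= 3 * n)%N -> (i <= n)%N ->
  exists s', [/\ perm_eq s' (enum V), (cgaps e s' * 3 ^ i.+1 <= 3 * n)%N &
    forall F, normal_weight F -> cwsum F s' <= cwsum F s + (m * (4 * i + 7))%:R].
Proof.
move=> + + + hi; elim: m s => [|m IH] s ps cm hm.
  exists s; split=> //; first by move: cm; rewrite leqn0 => /eqP->.
  by move=> F _; rewrite addr0.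
have [h|h] := leqP (cgaps e s * 3 ^ i.+1) (3 * n).
  by exists s; split=> // F _; rewrite lerDl.
have g0 : (0 < cgaps e s)%N by case: (cgaps e s) h.
(* The depth is 2i + 2 because 2^(2i+2) = 4 * 4^i exceeds 2 * 3^i, which suffices when the gap
   number is above n/3^i; the 2 covers the gap hidden at the seam. *)
have hk : (2 * i + 2 <= 2 * n + 2)%N by lia.
have hV : (n <= 2 ^ (2 * i + 2) * maxn 1 (cgaps e s).-1)%N.
  have E : (2 ^ (2 * i + 2) = 4 * 4 ^ i)%N by rewrite addnC expnD expnM.
  have E' : (3 ^ i <= 4 ^ i)%N by case: (i) => // i'; rewrite leq_exp2r.
  have h2 : (cgaps e s <= 2 * maxn 1 (cgaps e s).-1)%N by lia.
  have h3 : (n < cgaps e s * 3 ^ i)%N by move: h; rewrite expnS mulnCA ltn_mul2l.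
  apply: leq_trans (ltnW h3) _; apply: leq_trans (leq_mul h2 E') _.
  by rewrite E [leqLHS]mulnAC leq_mul2r leq_mul2r orbT orbT.
have [s1 [ps1 gs1 ws1]] := merge_gap sym1 sym2 irr1 exp1 hit12 ps g0 hk hV.
have [||s' [ps' gs' ws']] := IH s1 ps1.
- by rewrite -ltnS; apply: leq_trans gs1 cm.
- by apply: leq_trans hm; rewrite leq_mul2r leqnSn orbT.
exists s'; split=> // F [sF bF]; apply: le_trans (ws' F (conj sF bF)) _.
have := ws1 F sF bF; have -> : (2 * (2 * i + 2) + 3 = 4 * i + 7)%N by lia.
by move=> h'; rewrite mulSn [in leRHS]natrD addrA lerD2r.
Qed.

(** Phase k costs at most 3n/3^k times 14 * (3/2)^k, that is 42n/2^k, which is the telescoping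
    difference 84n (2^-k - 2^-(k+1)). *)
Lemma merge_phases i j s : perm_eq s (enum V) -> (cgaps e s * 3 ^ i <= 3 * n)%N ->
  (i + j <= n.+1)%N ->
  exists s', [/\ perm_eq s' (enum V), (cgaps e s' * 3 ^ (i + j) <= 3 * n)%N &
    forall F, normal_weight F ->
      cwsum F s' <= cwsum F s + 84 * n%:R * ((2 ^+ i)^-1 - (2 ^+ (i + j))^-1)].
Proof.
move=> ps hs; elim: j => [|j IH] hj.
  by exists s; split=> // [|F _]; rewrite addn0 // subrr mulr0 addr0.
have [|s1 [ps1 gs1 ws1]] := IH; first by lia.
have [|s' [ps' gs' ws']] := merge_phase ps1 (leqnn _) gs1; first by lia.
exists s'; rewrite addnS; split=> // F nF.
apply: le_trans (ws' F nF) _; have := ws1 F nF.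
set k := (i + j)%N in gs1 *; set c := cgaps e s1 in gs1 *.
have E : (2 ^+ k.+1)^-1 = (2 ^+ k)^-1 / 2 :> R.
  by rewrite exprS invfM mulrC.
have hc : c%:R <= 3 * n%:R / 3 ^+ k :> R.
  by rewrite ler_pdivlMr ?exprn_gt0 // -natrX -!natrM ler_nat.
have h : (4 * k + 7)%:R <= 14 * (3 / 2) ^+ k :> R.
  apply: (@le_trans _ _ (7 * k.+1%:R)); first by rewrite -natrM ler_nat; lia.
  by have := le_two_expr32 k; lra.
have : (c * (4 * k + 7))%:R <= 42 * n%:R * (2 ^+ k)^-1 :> R.
  rewrite natrM; apply: le_trans (ler_pM _ _ hc h) _ => //.
  rewrite -ratio_expr le_eqVlt; apply/orP; left; apply/eqP.
  by field; rewrite expf_neq0.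
rewrite E; lra.
Qed.

Lemma merge_all J s : perm_eq s (enum V) -> (cgaps e s * 3 ^ J <= 3 * n)%N -> (J <= n.+1)%N ->
  exists s', [/\ perm_eq s' (enum V), cgaps e s' = 0%N &
    forall F, normal_weight F -> cwsum F s' <= cwsum F s + 84 * n%:R / 2 ^+ J].
Proof.
move=> ps hs hJ; have [|s' [ps' gs' ws']] := merge_phases (j := n.+1 - J) ps hs.
  by rewrite subnKC.
exists s'; split=> //.
  (* After phase n fewer than one gap is left, since 3^n > n. *)
  move: gs'; rewrite subnKC // expnS; case: (cgaps e s') => // c.
  have := ltn_expl n (isT : 1 < 3)%N; nia.
move=> F nF; apply: le_trans (ws' F nF) _; rewrite lerD2l ler_wpM2l //.
by rewrite gerBl invr_ge0 exprn_ge0.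
Qed.

Variables (J : nat) (C : nat -> finType) (kappa : forall k, V -> C k).
Hypothesis kappa_coarser : forall k x y, kappa k x = kappa k y -> kappa k.+1 x = kappa k.+1 y.
Hypothesis card_cells : forall k, (k <= J)%N -> (#|C k| * 3 ^ k <= n)%N.
Hypothesis linked : forall k, (0 < k <= J)%N ->
  linked_cells e1 (kappa k) (n%:R / 3 ^+ k : R).
Variable F : V -> V -> R.
Hypothesis nF : normal_weight F.
Hypothesis Fcell : forall k x y, (k <= J)%N -> kappa k x = kappa k y ->
  F x y <= 2 ^+ k / 2 ^+ J.

(** Level k + 1 adds at most 3n/3^k links of length 2^(k+1)/2^J, hence 6n/2^J * (2/3)^k, and 18 =
    6/(1 - 2/3). The 3 in the last bound is 2 for the unmerged blocks and 1 for the cells. *)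
Lemma scale_blocks k : (k <= J)%N -> exists bs, [/\ perm_eq (flatten bs) (enum V),
  all (block e1) bs, constant_blocks (kappa k) bs,
  cost F bs <= 18 * n%:R / 2 ^+ J * (1 - (2 / 3) ^+ k) &
  (size bs)%:R <= 3 * n%:R / 3 ^+ k :> R].
Proof.
elim: k => [|k IH] hk.
  exists [seq [:: v] | v <- enum V]; split.
  - by rewrite (_ : flatten _ = enum V) //; elim: (enum V) => //= v l ->.
  - by apply/allP => b /mapP[v _ ->].
  - by move=> b /mapP[v _ ->] x y; rewrite !inE => /eqP-> /eqP->.
  - by rewrite /cost big_map big1 ?expr0 ?subrr ?mulr0 // => v _; rewrite wsum_seq1.
  - by rewrite size_map -cardE expr0 divr1; have : 0 <= n%:R :> R by []; lra.
have [bs [pbs abs kbs cbs sbs]] := IH (ltnW hk).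
have kbs' : constant_blocks (kappa k.+1) bs.
  by move=> b bb x y xb yb; apply: kappa_coarser; apply: kbs bb _ _ xb yb.
have d0 : 0 <= 2 ^+ k.+1 / 2 ^+ J :> R by rewrite divr_ge0 ?exprn_ge0.
have hl := linked (k := k.+1) hk.
have [bs' [h1 h2 h3 h4 h5]] := merge_level pbs abs kbs' d0 (fun x y => Fcell hk) hl.
exists bs'; split=> //; last first.
  apply: le_trans h5 _; have : #|C k.+1|%:R <= n%:R / 3 ^+ k.+1 :> R.
    by rewrite ler_pdivlMr ?exprn_gt0 // -natrX -natrM ler_nat card_cells.
  lra.
apply: le_trans h4 _; rewrite -(mulr_natr _ (size bs)).
have h : 2 ^+ k.+1 / 2 ^+ J * (size bs)%:R <= 6 * n%:R / 2 ^+ J * (2 / 3) ^+ k :> R.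
  apply: le_trans (ler_wpM2l d0 sbs) _.
  rewrite le_eqVlt; apply/orP; left; apply/eqP; rewrite exprS expr_div_n.
  by field; rewrite !expf_neq0.
rewrite [(2 / 3) ^+ k.+1]exprS; apply: le_trans (lerD cbs h) _.
by rewrite le_eqVlt; apply/orP; left; apply/eqP; field; rewrite expf_neq0.
Qed.

(** 105 = 18 + 3 + 84: the merging inside cells, the concatenation of the remaining 3n/3^J paths
    with links of weight up to 1, and the removal of the gaps. *)
Lemma cheap_tour : (0 < n)%N -> (2 ^ J <= n)%N ->
  exists s, [/\ perm_eq s (enum V), cgaps e s = 0%N & cwsum F s <= 105 * n%:R / 2 ^+ J].
Proof.
move=> n0 hJ; have [bs [pbs abs _ cbs sbs]] := scale_blocks (leqnn J).
have JN : (J <= n.+1)%N.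
  by apply: leq_trans (leqnSn _); apply: leq_trans hJ; apply/ltnW/ltn_expl.
have anil : all (fun b => b != [::]) bs by apply: sub_all abs => b /andP[].
set s := flatten bs in pbs *.
have s0 : (0 < size bs)%N.
  by rewrite lt0n size_eq0; apply: contraTneq n0 => E; rewrite cardE -(perm_size pbs) /s E.
have ws : wsum F s <= cost F bs + ((size bs).-1)%:R.
  apply: wsum_flatten => // u v _ _; by case: nF => _ /(_ u v)/andP[].
have gs : (gaps e s <= (size bs).-1)%N.
  (* With the indicator of non-edges as weight, [wsum_flatten] counts gaps: none inside blocks, at
     most one per junction. *)
  pose G u v : R := (~~ e u v)%:R.
  have GE l : wsum G l = (gaps e l)%:R.
    rewrite /wsum /gaps -sum1_count natr_sum [RHS]big_mkcond; apply: eq_bigr => q _.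
    by rewrite /G; case: (~~ _).
  have := @wsum_flatten R V G 1 bs; rewrite GE -(ler_nat R) => h.
  apply: le_trans (h _ _ anil) _ => //; first by move=> u v _ _; rewrite /G lern1; case: (~~ _).
  rewrite /cost big_seq big1 ?add0r // => b bb; rewrite GE.
  have /andP[_] := allP abs _ bb; case: b {bb} => // x p; rewrite /= path_steps => ap.
  apply/eqP; rewrite pnatr_eq0 eqn0Ngt -has_count -all_predC; apply/allP => q /(allP ap) /= h'.
  by rewrite negbK /addrel h'.
have [x [p Es]] : exists x p, s = x :: p.
  by move: n0; rewrite cardE -(perm_size pbs); case: (s) => // x p _; exists x, p.
have cs : (cgaps e s * 3 ^ J <= 3 * n)%N.
  have h : (cgaps e s <= size bs)%N.
    rewrite Es in gs *; rewrite cgaps_cons; apply: leq_trans (leq_add gs (leq_b1 _)) _.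
    by rewrite addn1 prednK.
  apply: leq_trans (leq_mul h (leqnn _)) _.
  by rewrite -(ler_nat R) !natrM natrX -ler_pdivlMr ?exprn_gt0.
have [s' [ps' gs' ws']] := merge_all pbs cs JN.
exists s'; split=> //; apply: le_trans (ws' F nF) _.
have wc : cwsum F s <= cost F bs + (size bs)%:R.
  have /andP[_ h] := nF.2 (last x p) x; move: ws; rewrite Es cwsum_cons.
  by rewrite -(prednK s0) -natr1 /=; lra.
have h3 : 3 * n%:R / 3 ^+ J <= 3 * n%:R / 2 ^+ J :> R.
  by rewrite ler_wpM2l ?expr2_le_expr3 // mulr_ge0.
have h4 : 18 * n%:R / 2 ^+ J * (1 - (2 / 3) ^+ J) <= 18 * n%:R / 2 ^+ J :> R.
  rewrite ler_piMr ?divr_ge0 ?mulr_ge0 ?exprn_ge0 // gerBl exprn_ge0 //; lra.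
lra.
Qed.

End Tour.

(** * Bernoulli random graphs *)

Section Mass.
Variables (R : realType) (T : finType) (w : T -> R).
Hypothesis w0 : forall x, (0 <= w x)%R.
Local Open Scope ring_scope.

Definition mass (A : T -> Prop) : R := \sum_(x | `[< A x >]) w x.

Lemma mass_ge0 A : 0 <= mass A.
Proof. by apply: sumr_ge0. Qed.

Lemma le_mass (A B : T -> Prop) : (forall x, A x -> B x) -> mass A <= mass B.
Proof.
move=> AB; rewrite /mass [leRHS](bigID (fun x => `[< A x >])) /=.
rewrite [X in _ <= X + _](_ : _ = \sum_(x | `[< A x >]) w x) ?lerDl ?sumr_ge0 //.
apply: eq_bigl => x; case: (asboolP (A x)) => Ax; rewrite ?andbF // andbT.
exact/asboolP/AB.
Qed.

Lemma mass_exists (I : finType) (P : pred I) (A : I -> T -> Prop) :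
  mass (fun x => exists2 i, P i & A i x) <= \sum_(i | P i) mass (A i).
Proof.
rewrite /mass; under [leRHS]eq_bigr do rewrite big_mkcond.
rewrite exchange_big /= big_mkcond; apply: ler_sum => x _.
case: asboolP => [[i Pi Aix]|_]; last by apply: sumr_ge0 => i _; case: ifP.
rewrite (bigD1 i) //=; case: asboolP => // _.
by rewrite lerDl sumr_ge0 // => j _; case: ifP.
Qed.

Lemma mass_or (A B : T -> Prop) : mass (fun x => A x \/ B x) <= mass A + mass B.
Proof.
have := mass_exists (I := bool) predT (fun b => if b then A else B).
rewrite big_bool => h; apply: le_trans h; apply: le_mass => x [Ax|Bx].
  by exists true.
by exists false.
Qed.

End Mass.

Section Bernoulli.
Variables (R : realType) (E : finType).
Implicit Types (q : R) (g : {ffun E -> bool}) (A : {set E}).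
Local Open Scope ring_scope.

Definition bern q g : R := \prod_(x : E) (if g x then q else 1 - q).

Lemma bern_ge0 q g : 0 <= q <= 1 -> 0 <= bern q g.
Proof.
by move=> /andP[q0 q1]; apply: prodr_ge0 => x _; case: ifP => // _; rewrite subr_ge0.
Qed.

Lemma sum_ffun_bool (f : E -> bool -> R) :
  \sum_(g : {ffun E -> bool}) \prod_x f x (g x) = \prod_x (f x true + f x false).
Proof. by rewrite -bigA_distr_bigA; apply: eq_bigr => x _; rewrite big_bool. Qed.

Lemma bern_sum1 q : \sum_g bern q g = 1.
Proof.
rewrite /bern (sum_ffun_bool (fun _ b => if b then q else 1 - q)).
by rewrite big1 // => x _; rewrite addrC subrK.
Qed.

Lemma mass_bern_all q A (b : bool) :
  mass (bern q) (fun g => forall x, x \in A -> g x = b) =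
  (if b then q else 1 - q) ^+ #|A|.
Proof.
rewrite /mass big_mkcond /=.
rewrite (eq_bigr (fun g : {ffun E -> bool} => \prod_x (if (x \in A) && (g x != b) then 0
   else if g x then q else 1 - q))); last first.
  move=> g _; case: asboolP => h.
    by apply: eq_bigr => x _; case: (boolP ((x \in A) && _)) => // /andP[xA /eqP]; rewrite h.
  have [x [xA nx]] : exists x, x \in A /\ g x != b.
    apply: contrapT => h'; apply: h => x xA; apply: contrapT => /eqP nx; apply: h'.
    by exists x.
  by rewrite (bigD1 x) //= xA nx mul0r.
rewrite (sum_ffun_bool (fun x c => if (x \in A) && (c != b) then 0 else if c then q else 1 - q)).
rewrite (bigID (mem A)) /= [X in _ * X]big1 ?mulr1; last first.
  by move=> x /negbTE ->; rewrite addrC subrK.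
rewrite (eq_bigr (fun=> if b then q else 1 - q)) ?prodr_const // => x ->.
by case: b; rewrite /= ?addr0 ?add0r.
Qed.

Definition orf g1 g2 : {ffun E -> bool} := [ffun x => g1 x || g2 x].

(** Sprinkling: an edge is absent from the union exactly if it is absent from both independent
    rounds. *)
Lemma mass_bern_or q q1 (A : {ffun E -> bool} -> Prop) : 1 - q = (1 - q1) ^+ 2 ->
  mass (bern q) A = \sum_g1 bern q1 g1 * mass (bern q1) (fun g2 => A (orf g1 g2)).
Proof.
move=> hq; rewrite /mass.
have -> : \sum_g1 bern q1 g1 * (\sum_(g2 | `[< A (orf g1 g2) >]) bern q1 g2) =
    \sum_g1 \sum_(g2 | `[< A (orf g1 g2) >]) bern q1 g1 * bern q1 g2.
  by apply: eq_bigr => g1 _; rewrite big_distrr.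
rewrite pair_big_dep /= (partition_big (fun i => orf i.1 i.2) (fun g => `[< A g >])) //=.
apply: eq_bigr => g Ag.
rewrite (eq_bigl (fun i => orf i.1 i.2 == g)); last first.
  by move=> i; apply/andP/idP => [[_ //]|/eqP E']; rewrite E' Ag eqxx.
rewrite big_mkcond -(pair_bigA _ (fun g1 g2 => if orf g1 g2 == g then bern q1 g1 * bern q1 g2 else 0)) /=.
pose f x (b1 b2 : bool) : R := if (b1 || b2) == g x
  then (if b1 then q1 else 1 - q1) * (if b2 then q1 else 1 - q1) else 0.
transitivity (\sum_(g1 : {ffun E -> bool}) \sum_(g2 : {ffun E -> bool}) \prod_x f x (g1 x) (g2 x)).
  under eq_bigr do rewrite (sum_ffun_bool (fun x b => f x _ b)).
  rewrite (sum_ffun_bool (fun x b => f x b true + f x b false)) /bern.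
  apply: eq_bigr => x _; rewrite /f; case: (g x) => /=; last by rewrite !add0r hq expr2.
  have -> : q = 1 - (1 - q1) ^+ 2 by rewrite -hq opprB addrC subrK.
  by rewrite /f /=; ring.
apply: eq_bigr => g1 _; apply: eq_bigr => g2 _; case: eqP => [Eg|ne].
  by rewrite /bern -big_split /=; apply: eq_bigr => x _; rewrite /f -Eg ffunE eqxx.
have [x nx] : exists x, (g1 x || g2 x) != g x.
  apply: contrapT => h; apply: ne; apply/ffunP => x; rewrite ffunE.
  by apply: contrapT => /eqP nx; apply: h; exists x.
by rewrite (bigD1 x) //= /f (negbTE nx) mul0r.
Qed.

(** As [b] bounds the second-round failure for every fixed [g1], it survives averaging over the
    first round. *)
Lemma mass_bern_two_rounds q q1 (A B : {ffun E -> bool} -> Prop)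
    (C : {ffun E -> bool} -> {ffun E -> bool} -> Prop) (b : R) :
  0 <= q1 <= 1 -> 1 - q = (1 - q1) ^+ 2 -> 0 <= b ->
  (forall g1 g2, A (orf g1 g2) -> B g1 \/ C g1 g2) ->
  (forall g1, mass (bern q1) (C g1) <= b) ->
  mass (bern q) A <= mass (bern q1) B + b.
Proof.
move=> q01 hq b0 hA hC; rewrite (mass_bern_or A hq).
have w0 g := @bern_ge0 q1 g q01.
apply: (@le_trans _ _ (\sum_g1 (bern q1 g1 * ((`[< B g1 >])%:R + b)))).
  apply: ler_sum => g1 _; apply: ler_wpM2l => //.
  case: asboolP => Bg /=.
    apply: (@le_trans _ _ 1); last by rewrite lerDl.
    rewrite -(bern_sum1 q1) /mass [leRHS](bigID (fun g2 => `[< A (orf g1 g2) >])) /=.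
    by rewrite lerDl sumr_ge0.
  rewrite add0r; apply: le_trans (hC g1); apply: le_mass => // g2 /hA[//|//].
under eq_bigr do rewrite mulrDr.
rewrite big_split /= -big_distrl /= bern_sum1 mul1r lerD2r /mass [leRHS]big_mkcond /=.
by apply: ler_sum => g1 _; case: (`[< B g1 >]); rewrite ?mulr1 ?mulr0.
Qed.

End Bernoulli.

Section RandomGraph.
Variables (R : realType) (n : nat).
Local Notation E := (vertex_pair n).
Implicit Types (g : {ffun E -> bool}) (q : R).
Local Open Scope ring_scope.

Definition joins (x : E) (i j : 'I_n) := (val x == (i, j)) || (val x == (j, i)).

Definition graph_of g : rel 'I_n := fun i j => [exists x : E, g x && joins x i j].

Lemma joinsC x i j : joins x i j = joins x j i.
Proof. by rewrite /joins orbC. Qed.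

Lemma graph_of_sym g : symmetric (graph_of g).
Proof. by move=> i j; apply: eq_existsb => x; rewrite joinsC. Qed.

Lemma graph_of_irr g : irreflexive (graph_of g).
Proof.
move=> i; apply/negbTE/existsP => -[x /andP[_]]; rewrite /joins orbb => /eqP h.
by have := valP x; rewrite h /= ltnn.
Qed.

Lemma graph_of_or g1 g2 : graph_of (orf g1 g2) = addrel (graph_of g1) (graph_of g2).
Proof.
apply/funext => i; apply/funext => j; apply/existsP/orP => [[x /andP[]]|].
  by rewrite ffunE => /orP[h1|h2] h; [left|right]; apply/existsP; exists x; rewrite ?h1 ?h2.
by case=> /existsP[x /andP[h1 h2]]; exists x; rewrite ffunE h1 h2 ?orbT.
Qed.

Lemma joinsE i j : i != j -> exists x : E, joins x i j.
Proof.
move=> ij; have [h|h|h] := ltngtP i j.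
- by exists (exist _ (i, j) h); rewrite /joins /= eqxx.
- by exists (exist _ (j, i) h); rewrite /joins /= eqxx orbT.
- by move: ij; rewrite (val_inj h) eqxx.
Qed.

Definition touched (Z : {set 'I_n * 'I_n}) : {set E} :=
  [set x | [exists z in Z, joins x z.1 z.2]].

Lemma card_touched (Z : {set 'I_n * 'I_n}) : {in Z, forall z, z.1 != z.2} -> (#|Z| <= 2 * #|touched Z|)%N.
Proof.
move=> dZ; set A := touched Z.
have sub : Z \subset [set val x | x in A] :|: [set swap (val x) | x in A].
  apply/fintype.subsetP => -[i j] zZ; have [x jx] := joinsE (dZ _ zZ).
  have xA : x \in A by rewrite inE; apply/existsP; exists (i, j); rewrite zZ.
  rewrite inE; apply/orP; case/orP: jx => /eqP h; [left|right]; apply/imsetP; exists x => //.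
  by rewrite h.
apply: leq_trans (subset_leq_card sub) _; apply: leq_trans (leq_card_setU _ _) _.
by rewrite mul2n -addnn leq_add // leq_imset_card.
Qed.

Lemma expR_bern q k : 0 <= q <= 1 -> (1 - q) ^+ k <= expR (- (q * k%:R)).
Proof.
move=> /andP[q0 q1]; rewrite -mulNr expRM_natr.
by rewrite lerXn2r ?nnegrE ?subr_ge0 ?expR_ge0 // expR_ge1Dx.
Qed.

(** The 2 in the exponent is the price of counting ordered pairs: an edge accounts for at most two
    of them. *)
Lemma mass_avoid q (Z : {set 'I_n * 'I_n}) (z : R) : 0 <= q <= 1 ->
  {in Z, forall z, z.1 != z.2} -> z <= #|Z|%:R ->
  mass (bern q) (fun g => {in Z, forall z, ~~ graph_of g z.1 z.2}) <= expR (- (q * z / 2)).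
Proof.
move=> q01 dZ hz; have /andP[q0 _] := q01.
apply: (@le_trans _ _ (expR (- (q * #|touched Z|%:R)))); last first.
  rewrite ler_expR lerN2 -mulrA ler_wpM2l // ler_pdivrMr //.
  by apply: le_trans hz _; rewrite -natrM ler_nat mulnC card_touched.
apply: le_trans (expR_bern _ q01); have := mass_bern_all q (touched Z) false => /= <-.
apply: le_mass; first by move=> g; apply: bern_ge0.
move=> g h x; rewrite inE => /existsP[z' /andP[zZ jx]].
apply/negP => gx; have /negP := h _ zZ; apply; apply/existsP; exists x.
by rewrite gx.
Qed.

Lemma index_steps (T : eqType) (s : seq T) u v : uniq s -> (u, v) \in steps s ->
  index v s = (index u s).+1.
Proof.
move=> us /stepsP[a [b E]]; move: us; rewrite E cat_uniq rcons_uniq.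
move=> /and3P[/andP[ua _] /hasPn h _].
have va : v \notin rcons a u by apply: h; rewrite mem_head.
move: va; rewrite mem_rcons inE negb_or => /andP[vu va].
rewrite !index_cat !mem_rcons !inE (negbTE vu) (negbTE va) eqxx /= eqxx addn0 size_rcons.
by rewrite -cats1 index_cat (negbTE ua) /= eqxx addn0.
Qed.

Lemma mass_path q (s : seq 'I_n) : 0 <= q <= 1 -> uniq s ->
  mass (bern q) (fun g => sorted (graph_of g) s) <= q ^+ (size s).-1.
Proof.
move=> q01 us; have /andP[q0 q1] := q01.
(* Both orientations are included so that the factor 2 of [card_touched] is not lost. *)
pose Z1 := [set z in steps s]%SET; pose Z := Z1 :|: [set z in map (@swap _) (steps s)]%SET.
have u1 : uniq (steps s) by apply: (@map_uniq _ _ fst); apply: uniq_unzip1_steps.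
have swK : cancel (@swap 'I_n) (@swap 'I_n) by case.
have u2 : uniq (map (@swap _) (steps s)) by rewrite map_inj_uniq //; apply: can_inj swK.
have step_ne u v : (u, v) \in steps s -> u != v.
  move=> /(index_steps us) h; apply: contra_eq_neq h => ->.
  by rewrite -[X in X != _]addn0 -addn1 eqn_add2l.
have dZ : {in Z, forall z, z.1 != z.2}.
  move=> [u v]; rewrite !inE => /orP[/step_ne //|/mapP[[u' v'] /step_ne h [-> ->]]].
  by rewrite /= eq_sym.
have cZ : #|Z| = (2 * (size s).-1)%N.
  rewrite cardsU (_ : _ :&: _ = finset.set0) ?cards0 ?subn0.
    by rewrite !cardsE (card_uniqP u1) (card_uniqP u2) size_map size_steps; lia.
  apply/finset.setP => -[u v]; rewrite !inE; apply/negP => /andP[/(index_steps us) h1].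
  by case/mapP=> -[v' u'] /(index_steps us) h2 [E1 E2]; subst; lia.
have h := card_touched dZ; rewrite cZ leq_mul2l /= in h.
apply: (@le_trans _ _ (q ^+ #|touched Z|)); last first.
  by apply: ler_wiXn2l.
have := mass_bern_all q (touched Z) true => /= <-.
apply: le_mass; first by move=> g; apply: bern_ge0.
move=> g sg x; rewrite inE => /existsP[[u v] /andP[zZ jx]].
have : graph_of g u v.
  have al : all (fun e => graph_of g e.1 e.2) (steps s).
    by case: (s) sg => // a l; rewrite -path_steps.
  move: zZ; rewrite !inE => /orP[/(allP al) //|/mapP[[u' v'] /(allP al) h' [-> ->]]].
  by rewrite graph_of_sym.
case/existsP=> y /andP[gy jy]; suff -> : x = y by [].
apply: val_inj => /=; move: jx jy (valP x) (valP y); rewrite /joins /=.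
by case/orP=> /eqP->; case/orP=> /eqP-> //=; lia.
Qed.

Lemma sum_set_expr (V : finType) (a : R) : \sum_(S : {set V}) a ^+ #|S| = (1 + a) ^+ #|V|.
Proof.
have -> : (1 + a) ^+ #|V| = \prod_(v : V) (a + 1) by rewrite prodr_const addrC.
rewrite bigA_distr; apply: eq_bigr => S _.
by rewrite -big_mkcond /= prodr_const.
Qed.

End RandomGraph.

(** * Union bounds for expansion, boosters and linked cells *)

Section UnionBounds.
Variables (R : realType) (n : nat).
Implicit Types (g : {ffun vertex_pair n -> bool}) (q : R).
Local Open Scope ring_scope.
Local Notation V := 'I_n.

Lemma expR_le1D2x (z : R) : 0 <= z <= 1 / 2 -> expR z <= 1 + 2 * z.
Proof.
move=> /andP[z0 z1]; have h := expR_ge1Dx (- z).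
have h1 : 0 < 1 - z by lra.
have : expR z <= (1 - z)^-1.
  by rewrite -[z in expR z]opprK expRN lef_pV2 ?posrE ?expR_gt0.
move/le_trans; apply; rewrite -[leLHS]mul1r ler_pdivrMr //; nra.
Qed.

Lemma expR_Nln k : (0 < n)%N -> expR (- (k%:R * ln n%:R)) = (n%:R ^+ k)^-1 :> R.
Proof. by move=> n0; rewrite expRN expRM_natl lnK // posrE ltr0n. Qed.

(** Each set of size at most m has weight n^(m-|T|) >= 1, and the weights of all sets add up to n^m
    (1 + 1/n)^n. *)
Lemma sum_card_le m : (0 < n)%N ->
  \sum_(T : {set V} | (#|T| <= m)%N) 1 <= expR 1 * n%:R ^+ m :> R.
Proof.
move=> n0; have n0' : 0 < n%:R :> R by rewrite ltr0n.
apply: (@le_trans _ _ (\sum_(T : {set V}) n%:R ^+ m * n%:R^-1 ^+ #|T|)).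
  rewrite big_mkcond; apply: ler_sum => T _; case: ifP => [hT|_].
    by rewrite exprVn ler_pdivlMr ?exprn_gt0 // mul1r ler_weXn2l // ler1n.
  by rewrite mulr_ge0 ?exprn_ge0 ?invr_ge0.
rewrite -big_distrr /= sum_set_expr card_ord mulrC ler_wpM2r ?exprn_ge0 //.
apply: le_trans (_ : expR (n%:R^-1) ^+ n <= _).
  by rewrite lerXn2r ?nnegrE ?addr_ge0 ?invr_ge0 ?expR_ge0 // expR_ge1Dx.
by rewrite -expRM_natl divff // gt_eqF.
Qed.

(** If S has too few neighbours T, all pairs from S to the outside of S and T, at least |S|n/2, are
    absent; this has probability at most n^(-11|S|), where 44 = 4 * 11. The choices of T cost e
    n^(8|S|), and the remaining n^-3 per vertex beats the choice of S. *)
Lemma mass_not_expander q : 0 <= q <= 1 -> 44 * ln n%:R <= q * n%:R ->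
  expR 1 * 2 <= n%:R :> R -> (0 < n)%N ->
  mass (bern q) (fun g : {ffun vertex_pair n -> bool} => ~ expander (graph_of g)) <= 2 * expR 1 / n%:R.
Proof.
move=> q01 hq hn n0; have n0' : 0 < n%:R :> R by rewrite ltr0n.
have n1 : 1 <= n%:R :> R by rewrite ler1n.
have e1 : 1 <= expR 1 :> R by have := expR_ge1Dx (1 : R); lra.
have w0 g := @bern_ge0 R _ q g q01.
pose P (ST : {set V} * {set V}) :=
  [&& (0 < #|ST.1|)%N, (18 * #|ST.1| <= n)%N & (#|ST.2| <= 8 * #|ST.1|)%N].
pose Z (ST : {set V} * {set V}) := finset.setX ST.1 (~: (ST.1 :|: ST.2)).
pose t : R := (n%:R ^+ 11)^-1.
apply: (@le_trans _ _ (\sum_(ST | P ST) t ^+ #|ST.1|)).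
  apply: le_trans (_ : mass (bern q) (fun g => exists2 ST, P ST &
      {in Z ST, forall z, ~~ graph_of g z.1 z.2}) <= _).
    apply: le_mass => // g ne; apply: contrapT => h; apply: ne => S hS.
    rewrite leqNgt; apply/negP => lt; apply: h; exists (S, neighbours (graph_of g) S).
      rewrite card_ord in hS; rewrite /P /= (ltnW lt) andbT hS andbT.
      by case: (#|S|) lt => // ; rewrite muln0 ltn0.
    move=> [x y]; rewrite !inE /= => /andP[xS]; rewrite negb_or negb_and => /andP[yS].
    rewrite yS /= => /existsPn /(_ x); by rewrite xS.
  apply: le_trans (mass_exists _ _ _) _ => //; apply: ler_sum => -[S T] /and3P[/= S0 hS hT].
  apply: le_trans (mass_avoid (z := #|S|%:R * (n%:R / 2)) q01 _ _) _.
  - move=> [x y]; rewrite !inE /= => /andP[xS]; rewrite negb_or => /andP[yS _].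
    by apply: contraNneq yS => <-.
  - rewrite /Z cardsX natrM ler_wpM2l //.
    have [cU _] := leq_card_setU S T; have := cardsCs (S :|: T); rewrite card_ord => c.
    have : (n <= 2 * #|~: (S :|: T)|)%N.
      move: cU c hT hS; move: #|S :|: T| #|~: (S :|: T)| #|S| #|T| => a1 a2 a3 a4; lia.
    by rewrite -(ler_nat R) natrM => h; lra.
  - have -> : t = expR (- (11%:R * ln n%:R)) by rewrite expR_Nln.
    rewrite -expRM_natr ler_expR mulNr lerN2.
    have : 0 <= #|S|%:R :> R by [].
    nra.
pose y : R := t * (expR 1 * n%:R ^+ 8).
have t0 : 0 <= t by rewrite invr_ge0 exprn_ge0.
have y0 : 0 <= y by rewrite !mulr_ge0 ?expR_ge0 ?exprn_ge0.
apply: (@le_trans _ _ (\sum_(S : {set V} | (0 < #|S|)%N) y ^+ #|S|)).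
  rewrite (eq_bigl (fun ST : {set V} * {set V} => ((0 < #|ST.1|)%N && (18 * #|ST.1| <= n)%N) &&
    (#|ST.2| <= 8 * #|ST.1|)%N)); last by move=> ST; rewrite /P andbA.
  rewrite -(pair_big_dep (fun S : {set V} => (0 < #|S|)%N && (18 * #|S| <= n)%N)
    (fun S T : {set V} => (#|T| <= 8 * #|S|)%N) (fun S _ => t ^+ #|S|)) /= big_mkcondr /=.
  apply: ler_sum => S S0; case: ifP => _; last by rewrite exprn_ge0.
  rewrite -[X in \sum_(_ | _) X]mul1r -big_distrl /= mulrC exprMn.
  rewrite ler_wpM2l ?exprn_ge0 //; apply: le_trans (sum_card_le _ n0) _.
  rewrite exprMn -exprM ler_wpM2r ?exprn_ge0 //.
  by rewrite -[leLHS]expr1 ler_weXn2l.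
have yE : n%:R * y = expR 1 / n%:R ^+ 2.
  by rewrite /y /t; field; rewrite gt_eqF.
have -> : \sum_(S : {set V} | (0 < #|S|)%N) y ^+ #|S| = (1 + y) ^+ n - 1.
  rewrite -[in RHS](card_ord n) -(sum_set_expr 'I_n y) [X in _ = X - _](bigD1 finset.set0) //=.
  by rewrite cards0 expr0 addrC addrK; apply: eq_bigl => S; rewrite card_gt0.
have h1 : (1 + y) ^+ n <= expR (n%:R * y).
  by rewrite expRM_natl lerXn2r ?nnegrE ?addr_ge0 ?expR_ge0 // expR_ge1Dx.
have n2 : n%:R <= n%:R ^+ 2 :> R by rewrite expr2 ler_peMl.
have h2 : 0 <= n%:R * y <= 1 / 2.
  rewrite mulr_ge0 //= yE ler_pdivrMr ?exprn_gt0 //; lra.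
have h3 := expR_le1D2x h2.
have h4 : expR 1 / n%:R ^+ 2 <= expR 1 / n%:R :> R.
  by rewrite ler_wpM2l ?expR_ge0 // lef_pV2 ?posrE ?exprn_gt0.
rewrite yE in h1 h3; move: h1 h3 h4; rewrite -mulrA => h1 h3 h4; lra.
Qed.

(** Avoiding n^2/324 ordered pairs has probability at most n^(-4n), as 2592 = 2 * 324 * 4; the
    choices number n^n * 2^n * (2n + 3), at most n^(3n). *)
Lemma mass_not_hits q (e1 : rel V) : 0 <= q <= 1 -> 2592 * ln n%:R <= q * n%:R ->
  (2 < n)%N ->
  mass (bern q) (fun g : {ffun vertex_pair n -> bool} => ~ hits R e1 (graph_of g)) <= n%:R^-1.
Proof.
move=> q01 hq n3; have n0 : (0 < n)%N by apply: leq_trans n3.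
have n0' : 0 < n%:R :> R by rewrite ltr0n.
have w0 g := @bern_ge0 R _ q g q01.
pose I : finType := (n.-tuple V * ({set V} * 'I_(2 * n + 3)))%type.
pose B (i : I) := boosters R (addrel e1 (kept (i.1 : seq V) i.2.1)) (i.2.2.+1 + i.2.2.+1) i.1.
pose P (i : I) := uniq i.1 && (n ^ 2 <= 324 * #|B i|)%N.
pose t : R := (n%:R ^+ (4 * n))^-1.
apply: le_trans (_ : mass (bern q) (fun g => exists2 i, P i &
    {in B i, forall z, ~~ graph_of g z.1 z.2}) <= _).
  apply: le_mass => // g nh; apply: contrapT => h; apply: nh => s D k us als hk /= hB.
  apply: contrapT => nq; apply: h.
  have szs : size s == n.
    by rewrite -(card_uniqP us) -[X in _ == X]card_ord; apply/eqP/eq_card => v; rewrite als.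
  rewrite card_ord -ltnS -addnS in hk; rewrite card_ord in hB.
  exists (Tuple szs, (D, Ordinal hk)); first by rewrite /P /= us.
  by move=> z zB; apply/negP => gz; apply: nq; exists z.
apply: le_trans (mass_exists _ _ _) _ => //.
apply: (@le_trans _ _ (\sum_(i : I) t)).
  rewrite big_mkcond; apply: ler_sum => i _; case: ifP => [/andP[ui hB]|_]; last first.
    by rewrite invr_ge0 exprn_ge0.
  apply: le_trans (mass_avoid (z := n%:R ^+ 2 / 324) q01 _ _) _.
  (* Boosters are off the diagonal: the two ends of a repetition-free order of more than one vertex
     differ. *)
  - move=> [w v]; rewrite !inE => -[p' [pp' /= lp' _ _]].
    have szp : size (w :: p') = n by rewrite (perm_size pp') size_tuple.
    have up' : uniq (w :: p') by rewrite (perm_uniq pp').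
    apply: contraTneq n3 => wv; rewrite -szp -leqNgt; case: p' up' lp' {pp' szp} => [|a p'] //=.
    by case/andP=> h _ lp'; move: h; rewrite wv -lp' mem_last.
  - by rewrite ler_pdivrMr // -natrX -natrM ler_nat mulnC.
  - have -> : t = expR (- ((4 * n)%:R * ln n%:R)) by rewrite expR_Nln.
    rewrite ler_expR lerN2 natrM.
    have : 0 <= n%:R * (q * n%:R - 2592 * ln n%:R) by rewrite mulr_ge0 ?subr_ge0.
    lra.
rewrite sumr_const /I !card_prod card_tuple !card_ord -[t *+ _]mulr_natr.
have hc : (n ^ n * (#|{set V}| * (2 * n + 3)) <= n ^ (3 * n))%N.
  rewrite (_ : (3 * n = n + (n + n))%N); last by lia.
  rewrite expnD leq_mul2l; apply/orP; right; rewrite expnD leq_mul //.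
    have -> : #|{set V}| = #|powerset [set: V]%SET|.
      by apply: eq_card => S; rewrite !inE finset.subsetT.
    by rewrite card_powerset cardsT card_ord leq_exp2r // ltnW.
  apply: leq_trans (_ : n ^ 3 <= _)%N; last by rewrite leq_exp2l // ltnW.
  have : (9 <= n * n)%N by apply: (@leq_mul 3 3).
  rewrite !expnS expn0 muln1 => h; have := leq_mul (leqnn n) h; lia.
rewrite mulrC /t ler_pdivrMr ?exprn_gt0 //.
apply: (@le_trans _ _ (n%:R ^+ (3 * n))); first by rewrite -natrX ler_nat.
rewrite ler_pdivlMl // -exprS ler_weXn2l ?ler1n //; lia.
Qed.

(** Cauchy-Schwarz, from the tangent of the square at the mean [t]. *)
Lemma sum_sqr_card (C : finType) (a : C -> nat) :
  ((\sum_c a c)%N%:R ^+ 2 <= #|C|%:R * \sum_c (a c)%:R ^+ 2 :> R).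
Proof.
have [C0|C0] := posnP #|C|.
  by rewrite C0 mul0r big1 ?expr0n // => c _; case: (fintype0 c C0).
have C0' : 0 < #|C|%:R :> R by rewrite ltr0n.
rewrite natr_sum; set S := \sum_c _; pose t := S / #|C|%:R.
have : \sum_c (2 * t * (a c)%:R - t ^+ 2) <= \sum_c (a c)%:R ^+ 2 :> R.
  apply: ler_sum => c _; have := sqr_ge0 ((a c)%:R - t); rewrite sqrrB; lra.
rewrite sumrB -big_distrr /= -/S sumr_const -[t ^+ 2 *+ _]mulr_natr => h.
apply: le_trans (ler_wpM2l (ltW C0') h).
by rewrite /t le_eqVlt; apply/orP; left; apply/eqP; field; rewrite gt_eqF.
Qed.

(** Exponential tilting: beyond size u, e^(-a s) is at most e^(-2u) e^((2-a) s), and the latter sums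
    over all sets to e^(-2u) (1 + e^(2-a))^n. *)
Lemma sum_large_sets (a u : R) : expR (2 - a) * n%:R <= u ->
  \sum_(S : {set V} | u < #|S|%:R) expR (- (a * #|S|%:R)) <= expR (- u).
Proof.
move=> hu; apply: (@le_trans _ _ (\sum_(S : {set V}) expR (- 2 * u) * expR (2 - a) ^+ #|S|)).
  rewrite big_mkcond; apply: ler_sum => S _; case: ifP => [hS|_]; last first.
    by rewrite mulr_ge0 ?exprn_ge0 ?expR_ge0.
  by rewrite -expRM_natr -expRD ler_expR; lra.
rewrite -big_distrr /= sum_set_expr card_ord.
apply: (@le_trans _ _ (expR (- 2 * u) * expR u)); last by rewrite -expRD ler_expR; lra.
rewrite ler_wpM2l ?expR_ge0 //; apply: le_trans (_ : expR (expR (2 - a)) ^+ n <= _).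
  by rewrite lerXn2r ?nnegrE ?addr_ge0 ?expR_ge0 // expR_ge1Dx.
by rewrite -expRM_natr ler_expR.
Qed.

(** By Cauchy-Schwarz the cells contain at least |S|^2/|C| >= u|S|/|C| pairs between S and U. The
    resulting exponent is shared equally by S and U, which gives the 4 and makes the double sum
    factor. *)
Lemma mass_not_linked q (C : finType) (kappa : V -> C) (u : R) : 0 <= q <= 1 ->
  0 <= u -> (0 < #|C|)%N -> expR (2 - q * u / (4 * #|C|%:R)) * n%:R <= u ->
  mass (bern q) (fun g : {ffun vertex_pair n -> bool} => ~ linked_cells (graph_of g) kappa u)
    <= expR (- u).
Proof.
move=> q01 u0 C0 hu; have w0 g := @bern_ge0 R _ q g q01.
have C0' : 0 < #|C|%:R :> R by rewrite ltr0n.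
set a := q * u / (4 * #|C|%:R) in hu.
pose P (SU : {set V} * {set V}) := [&& (u < #|SU.1|%:R) && (u < #|SU.2|%:R),
  [disjoint SU.1 & SU.2], #|SU.1| == #|SU.2| & [forall c, #|[set x in SU.1 | kappa x == c]| ==
    #|[set x in SU.2 | kappa x == c]|]].
pose Z (SU : {set V} * {set V}) := [set z | [&& z.1 \in SU.1, z.2 \in SU.2 & kappa z.1 == kappa z.2]]%SET.
apply: le_trans (_ : mass (bern q) (fun g => exists2 SU, P SU &
    {in Z SU, forall z, ~~ graph_of g z.1 z.2}) <= _).
  apply: le_mass => // g nl; apply: contrapT => h; apply: nl => S U dSU kSU nSU.
  rewrite leNgt; apply/negP => uS; apply: h.
  have sz : #|S| = #|U|.
    have cE (A : {set V}) : #|A| = (\sum_c #|[set x in A | kappa x == c]|)%N.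
      rewrite -sum1_card (partition_big kappa predT) //=; apply: eq_bigr => c _.
      by rewrite -sum1dep_card.
    by rewrite [LHS]cE [RHS]cE; apply: eq_bigr.
  exists (S, U); first by rewrite /P /= -sz uS dSU eqxx /=; apply/forallP => c; rewrite kSU.
  by move=> [x y]; rewrite !inE /= => /and3P[xS yU /eqP kxy]; apply: nSU.
apply: le_trans (mass_exists _ _ _) _ => //.
pose f (S : {set V}) := expR (- (a * #|S|%:R)).
apply: (@le_trans _ _ (\sum_(SU : {set V} * {set V} | (u < #|SU.1|%:R) && (u < #|SU.2|%:R))
    f SU.1 * f SU.2)); last first.
  rewrite -(pair_big (fun S : {set V} => u < #|S|%:R) (fun S : {set V} => u < #|S|%:R)
    (fun S U => f S * f U)) /= -big_distrlr /=.
  have h := sum_large_sets hu.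
  have h0 : 0 <= \sum_(S : {set V} | u < #|S|%:R) f S by apply: sumr_ge0 => S _; apply: expR_ge0.
  apply: le_trans (ler_pM h0 h0 h h) _.
  by rewrite -expRD ler_expR; lra.
rewrite big_mkcond [leRHS]big_mkcond /=; apply: ler_sum => -[S U] _ /=.
case: ifP => [/and4P[/= /[dup] /andP[uS _] -> dSU /eqP sz /forallP hc]|_]; last first.
  by case: ifP => // _; rewrite mulr_ge0 ?expR_ge0.
have cE (A : {set V}) : #|A| = (\sum_c #|[set x in A | kappa x == c]|)%N.
  rewrite -sum1_card (partition_big kappa predT) //=; apply: eq_bigr => c _.
  by rewrite -sum1dep_card.
have cZ : #|Z (S, U)| = (\sum_c #|[set x in S | kappa x == c]| ^ 2)%N.
  rewrite -sum1_card (partition_big (fun z => kappa z.1) predT) //=; apply: eq_bigr => c _.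
  rewrite -mulnn {2}(eqP (hc c)) -cardsX -sum1_card; apply: eq_bigl => -[x y]; rewrite !inE /=.
  case: (x \in S) (y \in U) => -[] /=; rewrite ?andbF //.
  by apply/idP/idP => /andP[/eqP-> /eqP->]; rewrite !eqxx.
have hZ : u * #|S|%:R / #|C|%:R <= #|Z (S, U)|%:R.
  have := sum_sqr_card (fun c => #|[set x in S | kappa x == c]|); rewrite -cE => hs.
  rewrite ler_pdivrMr // mulrC; apply: le_trans (_ : #|S|%:R ^+ 2 <= _).
    by rewrite expr2 ler_wpM2l // ltW.
  apply: le_trans hs _; rewrite mulrC cZ natr_sum; apply: ler_wpM2r => //.
  by apply: ler_sum => c _; rewrite natrX.
apply: le_trans (mass_avoid q01 _ hZ) _.
  move=> [x y]; rewrite !inE /= => /and3P[xS yU _]; apply: contraTneq yU => <-.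
  by rewrite (disjointFr dSU xS).
rewrite /f -sz -expRD ler_expR le_eqVlt; apply/orP; left; apply/eqP; rewrite /a.
by field; rewrite gt_eqF.
Qed.

End UnionBounds.

(** * Probability of a short tour for fixed cells *)

Section UpperProbability.
Variables (R : realType) (n d m J : nat).
Hypothesis mJ : m.+1 = (2 ^ J)%N.
Hypothesis d2 : (2 <= d)%N.
Local Notation V := 'I_n.
Local Notation cell := {ffun 'I_d -> 'I_m.+1}.
Local Open Scope ring_scope.

Definition same_cell (k : nat) (b c : cell) := forall j, (b j %/ 2 ^ k = c j %/ 2 ^ k)%N.

(* Only the cells of the positions enter: the edge lengths, rescaled to [0, 1],
   range over all weights compatible with the nested grids. *)
Definition has_short_tour (c : V -> cell) (g : {ffun vertex_pair n -> bool}) :=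
  forall F : V -> V -> R, normal_weight F ->
    (forall k x y, (k <= J)%N -> same_cell k (c x) (c y) -> F x y <= 2 ^+ k / 2 ^+ J) ->
  exists s, [/\ perm_eq s (enum V), cgaps (graph_of g) s = 0%N &
    cwsum F s <= 105 * n%:R / 2 ^+ J].

(** 2^(J-k) cells per axis; the successor form is what [inord] needs. *)
Definition coarse k : finType := {ffun 'I_d -> 'I_((2 ^ (J - k)).-1.+1)}.
Definition coarsen (c : V -> cell) k x : coarse k := [ffun j => inord (c x j %/ 2 ^ k)].

Lemma coarsenP c k x y : coarsen c k x = coarsen c k y <-> same_cell k (c x) (c y).
Proof.
have lt z j : (c z j %/ 2 ^ k < (2 ^ (J - k)).-1.+1)%N.
  rewrite prednK ?expn_gt0 // ltn_divLR ?expn_gt0 //.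
  apply: leq_trans (ltn_ord (c z j)) _; rewrite mJ -expnD leq_exp2l //.
  by rewrite addnC -leq_subLR.
split=> [/ffunP h j|h]; last by apply/ffunP => j; rewrite !ffunE h.
by have := h j; rewrite !ffunE => /(congr1 val); rewrite /= !inordK.
Qed.

Lemma card_coarse k : #|coarse k| = (2 ^ (d * (J - k)))%N.
Proof. by rewrite card_ffun !card_ord prednK ?expn_gt0 // -expnM mulnC. Qed.

(** On coarse grids u = n/3^k is only known to be at least n^(1/5). The cube leaves room for summing
    over all levels. *)
Lemma expR_pow_decay (u : R) : (0 < n)%N -> n%:R <= u ^+ 5 -> 0 <= u ->
  expR (- u) <= 15 ^+ 15 / n%:R ^+ 3.
Proof.
move=> n0 hu u0; have n0' : 0 < n%:R :> R by rewrite ltr0n.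
have h : (u / 15) ^+ 15 <= expR u.
  have -> : expR u = expR (u / 15) ^+ 15 by rewrite -expRM_natr divfK.
  rewrite lerXn2r ?nnegrE ?expR_ge0 ?divr_ge0 //.
  by have := expR_ge1Dx (u / 15); lra.
have h2 : n%:R ^+ 3 / 15 ^+ 15 <= expR u.
  apply: le_trans h; rewrite expr_div_n ler_wpM2r ?invr_ge0 ?exprn_ge0 //.
  by rewrite (_ : u ^+ 15 = (u ^+ 5) ^+ 3) ?lerXn2r ?nnegrE ?exprn_ge0 // -exprM.
rewrite expRN -[leRHS]invf_div lef_pV2 ?posrE ?expR_gt0 ?divr_gt0 ?exprn_gt0 //.
Qed.

Lemma mass_no_short_tour (p q : R) (c : V -> cell) : 0 <= q <= 1 -> 1 - p = (1 - q) ^+ 2 ->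
  2592 * ln n%:R <= q * n%:R -> 24 * 2 ^+ (d * J) <= q * n%:R ->
  (2 < n)%N -> expR 1 * 2 <= n%:R :> R ->
  mass (bern p) (fun g => ~ has_short_tour c g) <= (2 * expR 1 + 15 ^+ 15 + 1) / n%:R.
Proof.
move=> q01 hp hq hJ n3 ne; have n0 : (0 < n)%N by apply: leq_trans n3.
have n0' : 0 < n%:R :> R by rewrite ltr0n.
have n1 : 1 <= n%:R :> R by rewrite ler1n.
have /andP[q0 q1] := q01.
have w0 (g : {ffun vertex_pair n -> bool}) := @bern_ge0 R _ q g q01.
have Jn : (2 ^ (d * J) <= n)%N.
  rewrite -(ler_nat R) natrX; apply: le_trans (_ : q * n%:R <= _); last by rewrite ler_piMl.
  by apply: le_trans hJ; rewrite ler_peMl ?exprn_ge0 //; lra.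
have Jn2 : (2 ^ J <= n)%N.
  by apply: leq_trans Jn; rewrite leq_exp2l // leq_pmull // (leq_trans _ d2).
(* A coarsening step divides the number of cells by 2^d, which is at least 4. *)
have cardk k : (k <= J)%N -> (#|coarse k| * 3 ^ k <= n)%N.
  move=> hk; rewrite card_coarse; apply: leq_trans Jn.
  apply: leq_trans (_ : 2 ^ (d * (J - k)) * 2 ^ (2 * k) <= _)%N.
    by rewrite leq_mul2l (expnM 2 2 k); apply/orP; right; case: (k) => // k'; rewrite leq_exp2r.
  rewrite -expnD leq_exp2l // -[X in (_ <= d * X)%N](subnK hk) mulnDr leq_add2l leq_mul2r d2 orbT //.
pose u k : R := n%:R / 3 ^+ k.
have u0 k : 0 <= u k by rewrite divr_ge0 ?exprn_ge0.
have linkedk k : (k <= J)%N -> mass (bern q) (fun g : {ffun vertex_pair n -> bool} =>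
     ~ linked_cells (graph_of g) (coarsen c k) (u k)) <= 15 ^+ 15 / n%:R ^+ 3.
  move=> hk; apply: le_trans (mass_not_linked (coarsen c k) q01 (u0 k) _ _) _.
  - by rewrite card_coarse expn_gt0.
  - rewrite mulrC /u ler_wpM2l //; set a := q * _ / _.
    have h3 : (4 / 3) ^+ k >= 1 + k%:R / 3 :> R.
      elim: (k) => [|i IH]; first by rewrite expr0; lra.
      have h1 : 1 <= (4 / 3) ^+ i :> R by rewrite exprn_ege1 //; lra.
      by rewrite exprS -[i.+1%:R]natr1; lra.
    (* Origin of the 24: a >= 24 * 2^(dk)/(4 * 3^k) >= 6 * (4/3)^k, which grows fast enough for
       e^(2-a) <= 3^-k. *)
    have ha : 6 + 2 * k%:R <= a.
      apply: le_trans (_ : 6 * (4 / 3) ^+ k <= _); first by lra.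
      rewrite /a card_coarse natrX mulrA ler_pdivlMr; last by rewrite mulr_gt0 ?exprn_gt0.
      rewrite ler_pdivlMr ?exprn_gt0 //; apply: le_trans hJ.
      have EJ : (d * J = d * (J - k) + d * k)%N by rewrite -mulnDr subnK.
      rewrite expr_div_n EJ exprD.
      have h4 : 4 ^+ k <= 2 ^+ (d * k) :> R.
        rewrite (_ : 4 = 2 ^+ 2 :> R); last by rewrite expr2; lra.
        by rewrite -exprM ler_weXn2l ?ler1n // leq_mul2r d2 orbT.
      have h5 : 0 <= 2 ^+ (d * (J - k)) :> R by rewrite exprn_ge0.
      apply: le_trans (_ : 24 * (2 ^+ (d * (J - k)) * 4 ^+ k) <= _); last first.
        by rewrite ler_wpM2l // ler_wpM2l.
      by rewrite le_eqVlt; apply/orP; left; apply/eqP; field; rewrite expf_neq0.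
    apply: le_trans (_ : expR (- (k%:R * 2)) <= _); first by rewrite ler_expR; lra.
    rewrite expRN expRM_natl lef_pV2 ?posrE ?exprn_gt0 ?expR_gt0 // lerXn2r ?nnegrE ?expR_ge0 //.
    by have := expR_ge1Dx (2 : R); lra.
  - apply: expR_pow_decay => //; rewrite /u expr_div_n ler_pdivlMr ?exprn_gt0 //.
    rewrite -exprM mulnC exprM -!natrX -natrM ler_nat (expnS n) leq_mul2l; apply/orP; right.
    apply: leq_trans (_ : (4 ^ 4) ^ k <= _)%N; first by case: (k) => // k'; rewrite leq_exp2r.
    rewrite -expnM mulnC expnM leq_exp2r //; apply: leq_trans Jn.
    rewrite (_ : 4 = 2 ^ 2)%N // -expnM leq_exp2l // leq_mul //.
have n3' : 15 ^+ 15 / n%:R ^+ 3 *+ J <= 15 ^+ 15 / n%:R :> R.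
  rewrite -[leLHS]mulr_natr -mulrA ler_wpM2l ?exprn_ge0 // mulrC.
  rewrite ler_pdivrMr ?exprn_gt0 // exprS mulKf ?gt_eqF //.
  rewrite -natrX ler_nat; apply: leq_trans (_ : n <= _)%N; last first.
    by rewrite -{1}[n]expn1 leq_exp2l // ltnW.
  by apply: leq_trans Jn2; apply/ltnW/ltn_expl.
apply: le_trans (mass_bern_two_rounds (q1 := q) (b := n%:R^-1)
  (B := fun g1 => ~ expander (graph_of g1) \/ exists2 k : 'I_J, true &
    ~ linked_cells (graph_of g1) (coarsen c k.+1) (u k.+1))
  (C := fun g1 g2 => ~ hits R (graph_of g1) (graph_of g2)) q01 hp _ _ _) _.
- by rewrite invr_ge0.
- move=> g1 g2 nst; apply: contrapT => /not_orP[/not_orP[/contrapT ex nl] /contrapT ht].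
  apply: nst => F nF Fc; rewrite graph_of_or.
  have lk k : (0 < k <= J)%N -> linked_cells (graph_of g1) (coarsen c k) (u k).
    case: k => // k /= hk; apply: contrapT => h; apply: nl.
    by exists (Ordinal hk).
  have := @cheap_tour R _ _ _ (graph_of_sym g1) (graph_of_sym g2) (graph_of_irr g1) ex ht
     J coarse (coarsen c); rewrite !card_ord; apply=> //.
  + by move=> k x y /coarsenP h; apply/coarsenP => j; rewrite expnSr !divnMA h.
  + by move=> k x y hk /coarsenP; apply: Fc.
- by move=> g1; apply: mass_not_hits.
apply: (@le_trans _ _ (2 * expR 1 / n%:R + 15 ^+ 15 / n%:R + n%:R^-1)); last first.
  by rewrite -!mulrDl -[X in _ + X]mul1r -mulrDl.
rewrite lerD2r; apply: le_trans (mass_or w0 _ _) _; apply: lerD.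
  apply: mass_not_expander => //; apply: le_trans hq.
  by have := ln_ge0 n1; lra.
apply: le_trans (mass_exists w0 _ _) _.
apply: (@le_trans _ _ (\sum_(k < J) 15 ^+ 15 / n%:R ^+ 3)).
  by apply: ler_sum => k _; apply: linkedk.
by rewrite sumr_const card_ord.
Qed.

End UpperProbability.

(** * First moment of short paths *)

Section ChainSums.
Variables (R : realType) (C : finType) (f : C -> C -> R) (B : R).
Local Open Scope ring_scope.
Hypothesis f0 : forall b c, 0 <= f b c.
Hypothesis fB : forall b, \sum_c f b c <= B.

Lemma big_tuple_cons (k : nat) (F : k.+1.-tuple C -> R) :
  \sum_t F t = \sum_x \sum_(t : k.-tuple C) F [tuple of x :: t].
Proof.
rewrite pair_bigA /= (reindex (fun q : C * k.-tuple C => [tuple of q.1 :: q.2])) //=.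
exists (fun t => (thead t, [tuple of behead t])) => [[x t] _|t _] /=.
  by rewrite theadE; congr (_, _); apply: val_inj.
by rewrite -tuple_eta.
Qed.

Definition chain_prod (s : seq C) : R := \prod_(q <- steps s) f q.1 q.2.

Lemma sum_chain_from k x : \sum_(t : k.-tuple C) chain_prod (x :: t) <= B ^+ k.
Proof.
have B0 : 0 <= B by apply: le_trans (fB x); apply: sumr_ge0.
elim: k x => [|k IH] x.
  rewrite (big_pred1 [tuple]) => [|t]; last by apply/esym/eqP; rewrite [t]tuple0.
  by rewrite /chain_prod big_nil.
rewrite big_tuple_cons exprS; apply: le_trans (_ : \sum_y f x y * B ^+ k <= _).
  apply: ler_sum => y _; rewrite -[X in X <= _]/(\sum_(t : k.-tuple C) chain_prod [:: x, y & t]).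
  rewrite (eq_bigr (fun t : k.-tuple C => f x y * chain_prod (y :: t))); last first.
    by move=> t _; rewrite /chain_prod steps_cons2 big_cons.
  by rewrite -big_distrr /= ler_wpM2l.
by rewrite -big_distrl /= ler_wpM2r ?exprn_ge0.
Qed.

Lemma sum_chain k : \sum_(t : k.+1.-tuple C) chain_prod t <= #|C|%:R * B ^+ k.
Proof.
rewrite big_tuple_cons -sum1_card natr_sum big_distrl /=; apply: ler_sum => x _.
by rewrite mul1r; apply: sum_chain_from.
Qed.

Lemma steps_map (T U : Type) (h : T -> U) (s : seq T) :
  steps (map h s) = map (fun q => (h q.1, h q.2)) (steps s).
Proof. by elim: s => [|x [|y s] IH] //; rewrite steps_cons2 !map_cons -IH. Qed.

(** Read along [s], the cells form an arbitrary tuple: the first cell is free, and each further one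
    contributes a row sum of [f]. *)
Lemma sum_chain_order (n : nat) (s : n.+1.-tuple 'I_n.+1) : uniq s ->
  \sum_(c : {ffun 'I_n.+1 -> C}) \prod_(q <- steps s) f (c q.1) (c q.2) <= #|C|%:R * B ^+ n.
Proof.
move=> us; apply: le_trans (sum_chain n).
have E : #|s| = #|'I_n.+1| by rewrite (card_uniqP us) size_tuple card_ord.
have als v : v \in s.
  by have h : s =i 'I_n.+1 by [apply/(subset_cardP E)/fintype.subsetP]; rewrite h.
rewrite (reindex (fun c : {ffun 'I_n.+1 -> C} => map_tuple c s)) /=; last first.
  exists (fun t : n.+1.-tuple C => [ffun v => nth (tnth t ord0) t (index v s)]) => [c _|t _].
    apply/ffunP => v; rewrite ffunE (nth_map v) ?index_mem ?als //.
    by rewrite nth_index ?als.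
  apply: eq_from_tnth => i; rewrite tnth_map ffunE (tnth_nth ord0) index_uniq ?size_tuple //.
  by rewrite (tnth_nth (tnth t ord0) t i).
by apply: ler_sum => c _; rewrite /chain_prod steps_map big_map.
Qed.

End ChainSums.

Section LowerProbability.
Variables (R : realType) (n d m : nat).
Local Notation cell := {ffun 'I_d -> 'I_m.+1}.
Local Open Scope ring_scope.

(** The l1 distance: one of the two truncated differences always vanishes. *)
Definition cell_dist (b c : cell) : nat := (\sum_j ((b j - c j) + (c j - b j)))%N.

Lemma sum_half_dist (a N : nat) :
  \sum_(k < N) (2^-1 : R) ^+ ((a - k) + (k - a)) <= 4.
Proof.
have h1 i : (i <= a)%N -> \sum_(k < i) (2^-1 : R) ^+ ((a - k) + (k - a)) <= 2^-1 ^+ (a - i).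
  elim: i => [|i IH] hi; first by rewrite big_ord0 exprn_ge0 // invr_ge0.
  rewrite big_ord_recr /=; have := IH (ltnW hi).
  rewrite (_ : (i - a = 0)%N) ?addn0; last by apply/eqP; rewrite subn_eq0 ltnW.
  by rewrite (_ : (a - i = (a - i.+1).+1)%N) ?exprS; [lra | lia].
have h2 i : \sum_(k < a + i) (2^-1 : R) ^+ ((a - k) + (k - a)) <= 4 - 2 * 2^-1 ^+ i.
  elim: i => [|i IH].
    by rewrite addn0; apply: le_trans (h1 _ (leqnn a)) _; rewrite subnn !expr0; lra.
  rewrite addnS big_ord_recr /= addKn (_ : (a - (a + i) = 0)%N) ?add0n; last by lia.
  by rewrite exprS; lra.
have [hN|hN] := leqP N a.
  apply: le_trans (h1 _ hN) _; apply: (@le_trans _ _ 1); last by lra.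
  by rewrite exprn_ile1 ?invr_ge0 //; lra.
rewrite -(subnKC (ltnW hN)); apply: le_trans (h2 _) _.
have : 0 <= (2^-1 : R) ^+ (N - a) by rewrite exprn_ge0 // invr_ge0.
lra.
Qed.

Lemma sum_cell_dist (b : cell) : \sum_c (2^-1 : R) ^+ cell_dist b c <= 4 ^+ d.
Proof.
rewrite (eq_bigr (fun c : cell => \prod_j (2^-1 : R) ^+ ((b j - c j) + (c j - b j)))); last first.
  by move=> c _; rewrite /cell_dist expr_sum.
rewrite -(bigA_distr_bigA (fun j (k : 'I_m.+1) => (2^-1 : R) ^+ ((b j - k) + (k - b j)))) /=.
rewrite -[X in 4 ^+ X]card_ord -prodr_const; apply: ler_prod => j _.
by rewrite sum_half_dist sumr_ge0 // => k _; rewrite exprn_ge0 // invr_ge0.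
Qed.

Definition has_short_path (c : {ffun 'I_n -> cell}) (g : {ffun vertex_pair n -> bool}) :=
  exists s : seq 'I_n, [/\ uniq s, size s = n, sorted (graph_of g) s &
    (\sum_(q <- steps s) cell_dist (c q.1) (c q.2) <= 2 * d * n)%N].

End LowerProbability.

Section ConfigWeight.
Variables (R : realType) (n d m : nat).
Local Notation cell := {ffun 'I_d -> 'I_m.+1}.
Local Notation config := ({ffun 'I_n -> cell} * {ffun vertex_pair n -> bool})%type.
Local Open Scope ring_scope.
Variables (w : 'I_n -> cell -> R) (p : R).
Hypothesis w_ge0 : forall v b, 0 <= w v b.
Hypothesis p01 : 0 <= p <= 1.

Definition config_weight (x : config) : R := (\prod_v w v (x.1 v)) * bern p x.2.

Lemma config_weight_ge0 x : 0 <= config_weight x.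
Proof. by rewrite mulr_ge0 ?bern_ge0 // prodr_ge0. Qed.

Lemma mass_config_le (Q : {ffun 'I_n -> cell} -> {ffun vertex_pair n -> bool} -> Prop) (a : R) :
  (forall v, \sum_b w v b = 1) -> (forall c, mass (bern p) (Q c) <= a) ->
  mass config_weight (fun x => Q x.1 x.2) <= a.
Proof.
move=> w1 hQ; rewrite /mass.
rewrite -(pair_big_dep predT (fun c g => `[< Q c g >])
  (fun c g => (\prod_v w v (c v)) * bern p g)) /=.
apply: (@le_trans _ _ (\sum_(c : {ffun 'I_n -> cell}) (\prod_v w v (c v)) * a)).
  by apply: ler_sum => c _; rewrite -big_distrr /= ler_wpM2l ?prodr_ge0 //; apply: hQ.
by rewrite -big_distrl /= -(bigA_distr_bigA w) big1 ?mul1r.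
Qed.

End ConfigWeight.

Section LowerMass.
Variables (R : realType) (n d m : nat).
Local Notation cell := {ffun 'I_d -> 'I_m.+1}.
Local Notation config := ({ffun 'I_n.+1 -> cell} * {ffun vertex_pair n.+1 -> bool})%type.
Local Open Scope ring_scope.
Variables (w : 'I_n.+1 -> cell -> R) (p : R).
Hypothesis w_bound : forall v b, 0 <= w v b <= (m.+1%:R ^+ d)^-1.
Hypothesis p01 : 0 <= p <= 1.

Let w_ge0 v b : 0 <= w v b. Proof. by have /andP[] := w_bound v b. Qed.
Local Notation joint_weight := (config_weight w p).
Let joint_weight_ge0 x : 0 <= joint_weight x := config_weight_ge0 w_ge0 p01 x.

(** Exponential Markov inequality: the indicator of D <= T is at most 2^T 2^-D, and 2^-D is a
    product along the order. With T = 2d(n+1), the factor 2^T gives one 4^d per vertex and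
    [sum_cell_dist] another one per link. *)
Lemma mass_near_chain (s : n.+1.-tuple 'I_n.+1) : uniq s ->
  mass (fun c : {ffun 'I_n.+1 -> cell} => \prod_v w v (c v))
    (fun c => (\sum_(q <- steps s) cell_dist (c q.1) (c q.2) <= 2 * d * n.+1)%N) <=
  4 ^+ d * (16 ^+ d / m.+1%:R ^+ d) ^+ n.
Proof.
move=> us; set M := m.+1%:R ^+ d; have M0 : 0 < M by rewrite exprn_gt0.
pose f (b c : cell) : R := 2^-1 ^+ cell_dist b c.
pose T := (2 * d * n.+1)%N.
have f0 b c : 0 <= f b c by rewrite exprn_ge0 // invr_ge0.
apply: (@le_trans _ _ (\sum_(c : {ffun 'I_n.+1 -> cell})
    (M^-1 ^+ n.+1 * 2 ^+ T) * \prod_(q <- steps s) f (c q.1) (c q.2))).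
  rewrite /mass big_mkcond; apply: ler_sum => c _.
  have P0 : 0 <= \prod_(q <- steps s) f (c q.1) (c q.2) by apply: prodr_ge0.
  case: asboolP => [hD|_]; last by rewrite !mulr_ge0 // exprn_ge0 // invr_ge0 ltW.
  rewrite -mulrA -[X in X <= _]mulr1; apply: ler_pM => //.
  - by apply: prodr_ge0 => v _; have /andP[] := w_bound v (c v).
  - rewrite -[X in _ ^+ X](card_ord n.+1) -prodr_const; apply: ler_prod => v _; exact: w_bound.
  - rewrite /f -expr_sum exprVn ler_pdivlMr ?exprn_gt0 // mul1r ler_weXn2l //.
    by rewrite ler1n.
rewrite -big_distrr /=.
have h := sum_chain_order f0 (@sum_cell_dist R d m) us.
apply: le_trans (ler_wpM2l _ h) _.
  by rewrite mulr_ge0 ?exprn_ge0 // invr_ge0 ltW.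
have -> : #|cell|%:R = M :> R by rewrite card_ffun !card_ord natrX.
have -> : 2 ^+ T = 4 ^+ d * (4 ^+ d) ^+ n :> R.
  by rewrite -exprS /T -exprM (_ : 4 = 2 ^+ 2 :> R) -?exprM ?mulnA //; rewrite expr2; lra.
rewrite (_ : 16 ^+ d = 4 ^+ d * 4 ^+ d :> R); last by rewrite -exprMn; congr (_ ^+ _); lra.
rewrite le_eqVlt; apply/orP; left; apply/eqP.
rewrite !exprMn !exprVn exprS; field; rewrite !expf_neq0 ?gt_eqF //.
Qed.

Lemma sqr_le_expn2 k : (k ^ 2 <= 2 * 2 ^ k)%N.
Proof.
elim: k => [|[|[|k]] IH] //; rewrite [X in (_ <= 2 * X)%N]expnS.
by move: IH; rewrite !expnS !expn0 => IH; nia.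
Qed.

(** Orders are counted crudely as all tuples. The hypothesis makes each link contribute at most 1/2,
    which leaves 4^d N 2^-(N-1) for N = n + 1 vertices. *)
Lemma mass_short_path : 2 * 16 ^+ d * n.+1%:R * p <= m.+1%:R ^+ d ->
  mass joint_weight (fun x => has_short_path x.1 x.2) <= 4 * 4 ^+ d / n.+1%:R.
Proof.
move=> hM; have /andP[p0 p1] := p01.
set M := m.+1%:R ^+ d in hM; have M0 : 0 < M by rewrite exprn_gt0.
pose A (s : n.+1.-tuple 'I_n.+1) (x : config) := sorted (graph_of x.2) s /\
  (\sum_(q <- steps s) cell_dist (x.1 q.1) (x.1 q.2) <= 2 * d * n.+1)%N.
apply: le_trans (_ : mass joint_weight (fun x => exists2 s, uniq (val s) & A s x) <= _).
  apply: le_mass => [|[c g] [s [us ss gs ds]]]; first exact: joint_weight_ge0.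
  have szs : size s == n.+1 by rewrite ss.
  by exists (Tuple szs).
apply: le_trans (mass_exists joint_weight_ge0 _ _) _.
pose b : R := p ^+ n * (4 ^+ d * (16 ^+ d / M) ^+ n).
have b0 : 0 <= b by rewrite !mulr_ge0 ?exprn_ge0 // divr_ge0 ?exprn_ge0 // ltW.
apply: (@le_trans _ _ (\sum_(s : n.+1.-tuple 'I_n.+1) b)).
  rewrite big_mkcond; apply: ler_sum => s _; case: ifP => // us.
  rewrite /b [leRHS]mulrC.
  have hs : (size s).-1 = n by rewrite size_tuple.
  have h1 := mass_path p01 us; rewrite hs in h1; have h2 := mass_near_chain us.
  apply: le_trans (ler_pM _ _ h2 h1); last 2 first.
  - apply: mass_ge0 => c; apply: prodr_ge0 => v _; by have /andP[] := w_bound v (c v).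
  - by apply: mass_ge0 => g; apply: bern_ge0.
  rewrite /mass big_distrlr /= pair_big /= le_eqVlt; apply/orP; left; apply/eqP.
  apply: eq_bigl => -[c g] /=; apply/asboolP/andP => [[h3 h4]|[/asboolP h3 /asboolP h4]].
    by split; apply/asboolP.
  by split.
rewrite sumr_const card_tuple card_ord -[b *+ _]mulr_natr natrX.
have -> : b * n.+1%:R ^+ n.+1 = 4 ^+ d * n.+1%:R * (16 ^+ d * n.+1%:R * p / M) ^+ n.
  by rewrite /b exprS !exprMn !exprVn; ring.
have h : (16 ^+ d * n.+1%:R * p / M) ^+ n <= (2^-1) ^+ n.
  rewrite lerXn2r ?nnegrE ?invr_ge0 // ?divr_ge0 ?mulr_ge0 ?exprn_ge0 ?(ltW M0) //.
  by rewrite ler_pdivrMr //; lra.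
have d0 : 0 <= 4 ^+ d * n.+1%:R :> R by rewrite mulr_ge0 ?exprn_ge0.
apply: le_trans (ler_wpM2l d0 h) _.
rewrite ler_pdivlMr ?ltr0n // exprVn mulrAC ler_pdivrMr ?exprn_gt0 //.
have h5 := sqr_le_expn2 n.+1; rewrite -(ler_nat R) natrX natrM natrX exprS in h5.
have h6 : 0 <= 4 ^+ d :> R by rewrite exprn_ge0.
move: h5; rewrite [in X in _ <= X]exprS; move: (2 ^+ n) (4 ^+ d) h6 => u v v0 h5.
nra.
Qed.

End LowerMass.

(** * Discretization *)

Section Slabs.
Variables (R : realType) (m : nat).
Local Open Scope classical_set_scope.
Local Open Scope ring_scope.

(* The last slab absorbs the right end of [0, 1]. *)
Definition slab_index (x : R) : 'I_m.+1 := inord (minn m (Num.truncn (m.+1%:R * x))).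

Lemma slab_indexE x : slab_index x = minn m (Num.truncn (m.+1%:R * x)) :> nat.
Proof. by rewrite inordK // ltnS geq_minl. Qed.

Lemma slab_index_bounds x : 0 <= x <= 1 ->
  (slab_index x)%:R <= m.+1%:R * x <= (slab_index x).+1%:R.
Proof.
move=> /andP[x0 x1]; have y0 : 0 <= m.+1%:R * x by rewrite mulr_ge0.
have /andP[h1 h2] := truncn_itv y0; rewrite slab_indexE.
have [h|h] := leqP m (Num.truncn (m.+1%:R * x)); last by rewrite h1 ltW.
apply/andP; split; first by apply: le_trans h1; rewrite ler_nat.
by rewrite ler_piMr.
Qed.

Lemma measurable_slab (k : 'I_m.+1) : measurable [set x : R | slab_index x = k].
Proof.
have mt (j : nat) : measurable [set x : R | (j <= Num.truncn ((m.+1%:R : R) * x))%N].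
  case: j => [|j].
    by rewrite (_ : [set x | _] = setT) //; apply/seteqP; split.
  rewrite (_ : [set x | _] = `[j.+1%:R / m.+1%:R, +oo[%classic) //.
  apply/seteqP; split=> x /=; rewrite in_itv /= andbT truncn_gt_nat ler_pdivrMr ?ltr0n // mulrC //.
have [km|km] := ltnP k m.
  rewrite (_ : [set x | _] = [set x | (k <= Num.truncn ((m.+1%:R : R) * x))%N] `\`
    [set x | (k.+1 <= Num.truncn ((m.+1%:R : R) * x))%N]); first exact: measurableD.
  apply/seteqP; split=> x /=.
    move=> E; have := slab_indexE x; rewrite E => Ek; split; first by rewrite Ek geq_minr.
    by apply/negP; move: km; rewrite Ek; lia.
  case=> h1 /negP; rewrite -leqNgt => h2; apply: val_inj; rewrite /= slab_indexE /=; lia.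
rewrite (_ : [set x | _] = [set x | (m <= Num.truncn ((m.+1%:R : R) * x))%N]) //.
have Ek : k = m :> nat by apply/eqP; rewrite eqn_leq km -ltnS ltn_ord.
apply/seteqP; split=> x /=.
  by move=> E; have := slab_indexE x; rewrite E Ek; lia.
by move=> h; apply: val_inj; rewrite /= slab_indexE /= Ek; lia.
Qed.

Definition unit_slab (k : 'I_m.+1) : set R := [set x | slab_index x = k] `&` `[0, 1].

Lemma measurable_unit_slab k : measurable (unit_slab k).
Proof. by apply: measurableI => //; apply: measurable_slab. Qed.

Lemma lebesgue_unit_slab k : (lebesgue_measure (unit_slab k) <= (m.+1%:R^-1)%:E)%E.
Proof.
have -> : (m.+1%:R^-1)%:E = lebesgue_measure (`[k%:R / m.+1%:R, k.+1%:R / m.+1%:R]%classic : set R).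
  rewrite lebesgue_measure_itv /= lte_fin ltr_pM2r ?invr_gt0 ?ltr0n // ltr_nat ltnSn.
  by rewrite -EFinB -mulrBl -natrB // subSnn mul1r.
apply: le_measure; rewrite ?inE //; first exact: measurable_unit_slab.
move=> x [/= E]; rewrite in_itv /= => x01; have := slab_index_bounds x01; rewrite E.
by rewrite in_itv /= ler_pdivrMr ?ltr0n // ler_pdivlMr ?ltr0n // [x * _]mulrC.
Qed.

End Slabs.

Section LebesgueTuple.
Variable R : realType.
Local Open Scope classical_set_scope.
Local Open Scope ring_scope.

Lemma lebesgue_tuple0 d : @lebesgue_tuple R d set0 = 0%E.
Proof.
elim: d => [|d IH] /=; first by rewrite /dirac indicE in_set0.
rewrite (_ : (fun x : R => _) = cst 0%E); first exact: integral0.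
by apply/funext => x; rewrite -[RHS]IH; congr lebesgue_tuple; apply/seteqP; split.
Qed.

(** The section at x is the box of the remaining sides if x lies in the first side, and empty
    otherwise. *)
Lemma lebesgue_tuple_box d (B : 'I_d -> set R) : (forall j, measurable (B j)) ->
  lebesgue_tuple [set t : d.-tuple R | forall j, B j (tnth t j)] =
  (\prod_(j < d) lebesgue_measure (B j))%E.
Proof.
elim: d B => [|d IH] B mB /=.
  by rewrite big_ord0 /dirac indicE mem_set // => -[].
rewrite big_ord_recl; set c := (\prod_(j < d) lebesgue_measure (B (lift ord0 j)))%E.
transitivity (\int[lebesgue_measure]_(x in [set: R]) (cst c \_ (B ord0)) x)%E.
  apply: eq_integral => x _; rewrite patchE; case: ifPn => [|/negP] hx.
    rewrite /c -IH //; congr lebesgue_tuple; apply/seteqP; split=> t /= h.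
      by move=> j; have := h (lift ord0 j); rewrite tnthS.
    move=> j; case: (unliftP ord0 j) => [j' ->|->]; first by rewrite tnthS.
    by rewrite tnth0; apply: set_mem.
  rewrite -[RHS](lebesgue_tuple0 d); congr lebesgue_tuple; apply/seteqP; split=> t //= h.
  by apply: hx; apply/mem_set; have := h ord0; rewrite tnth0.
rewrite -integral_mkcond integral_cst; [exact: muleC|exact: mB].
Qed.

End LebesgueTuple.

Section FiniteLaw.
Context {R : realType} {disp : measure_display} {Omega : measurableType disp}.
Variables (P : probability Omega R) (T : finType) (f : Omega -> T).
Local Open Scope classical_set_scope.
Local Open Scope ring_scope.
Hypothesis mf : forall x, measurable [set w | f w = x].

Lemma finite_law_seq (r : seq T) : uniq r -> measurable [set w | f w \in r] /\
  P [set w | f w \in r] = (\sum_(x <- r) P [set w | f w = x])%E.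
Proof.
elim: r => [|x r IH] /=.
  rewrite big_nil (_ : [set w | _] = set0) ?measure0; last by apply/seteqP; split.
  by split.
move=> /andP[xr /IH[mr Pr]].
have E : [set w | f w \in x :: r] = [set w | f w = x] `|` [set w | f w \in r].
  apply/seteqP; split=> w /=; rewrite inE; first by case/orP=> [/eqP|]; [left|right].
  by case=> [->|->]; rewrite ?eqxx ?orbT.
rewrite E big_cons -Pr; split; first exact: measurableU.
apply: measureU => //; apply/seteqP; split=> w //= [-> ]; by rewrite (negbTE xr).
Qed.

Lemma finite_law (Q : T -> Prop) : measurable [set w | Q (f w)] /\
  P [set w | Q (f w)] = (\sum_(x | `[< Q x >]) P [set w | f w = x])%E.
Proof.
have [m1 P1] := finite_law_seq (enum_uniq [pred x | `[< Q x >]]).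
have -> : [set w | Q (f w)] = [set w | f w \in enum [pred x | `[< Q x >]]].
  by apply/seteqP; split=> w /=; rewrite mem_enum => h; exact/asboolP.
by split=> //; rewrite P1 big_enum.
Qed.

End FiniteLaw.

Section Discretization.
Context {R : realType} {disp : measure_display} {Omega : measurableType disp}.
Variables (P : probability Omega R) (d n : nat) (p : R).
Variables (X : 'I_n -> Omega -> d.-tuple R) (G : Omega -> rel 'I_n).
Hypothesis H : embedded_random_graph P p X G.
Variable m : nat.
Local Open Scope classical_set_scope.
Local Open Scope ring_scope.
Local Notation cell := {ffun 'I_d -> 'I_m.+1}.

Definition cell_of (x : d.-tuple R) : cell := [ffun j => slab_index m (tnth x j)].
Definition cells w : {ffun 'I_n -> cell} := [ffun v => cell_of (X v w)].
Definition bits w : {ffun vertex_pair n -> bool} :=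
  [ffun e : vertex_pair n => G w (val e).1 (val e).2].

Lemma graph_of_bits w : graph_of (bits w) = G w.
Proof.
apply/funext => i; apply/funext => j; apply/existsP/idP => [[x]|gij].
  rewrite ffunE /joins => /andP[gx /orP[]/eqP E]; move: gx; rewrite E //=.
  by rewrite (graph_symmetric H).
have ij : i != j by apply: contraTneq gij => ->; rewrite (graph_irreflexive H).
have [x jx] := joinsE ij; exists x; rewrite ffunE jx andbT.
by case/orP: jx => /eqP -> //=; rewrite (graph_symmetric H).
Qed.

Lemma measurable_cell (b : cell) : measurable [set x : d.-tuple R | cell_of x = b].
Proof.
have -> : [set x | cell_of x = b] =
    \bigcap_(j in [set: 'I_d]) ((fun x : d.-tuple R => tnth x j) @^-1` [set y | slab_index m y = b j]).
  apply/seteqP; split=> [x /= <- j _ /=|x h]; first by rewrite ffunE.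
  by apply/ffunP => j; rewrite ffunE; apply: (h j).
apply: fin_bigcap_measurable => // j _; rewrite -[X in measurable X]setTI.
by apply: measurable_tnth => //; apply: measurable_slab.
Qed.

Lemma measurable_cell_event v (b : cell) : measurable [set w | cell_of (X v w) = b].
Proof.
rewrite -[X in measurable X]setTI; have [mX _] := position_uniform H v.
by apply: (mX measurableT [set x | cell_of x = b]); apply: measurable_cell.
Qed.

Definition cell_prob v (b : cell) : R := fine (P [set w | cell_of (X v w) = b]).

Lemma cell_probE v b : P [set w | cell_of (X v w) = b] = (cell_prob v b)%:E.
Proof.
by rewrite /cell_prob fineK //; apply: fin_num_measure; apply: measurable_cell_event.
Qed.

Lemma cell_prob_bound v b : 0 <= cell_prob v b <= (m.+1%:R ^+ d)^-1.
Proof.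
rewrite -!lee_fin -cell_probE measure_ge0 /=.
have [_ /(_ _ (measurable_cell b)) PX] := position_uniform H v.
rewrite [X in (X <= _)%E]PX.
have -> : [set x : d.-tuple R | cell_of x = b] `&` unit_cube (R:=R) (d:=d) =
    [set t : d.-tuple R | forall j, @unit_slab R m (b j) (tnth t j)].
  apply/seteqP; split=> t /=.
    by case=> <- h j; split; rewrite /= ?ffunE // in_itv /=; apply: h.
  move=> h; split=> [|j]; last by have [_ /=] := h j; rewrite in_itv.
  by apply/ffunP => j; rewrite ffunE; case: (h j).
rewrite (@lebesgue_tuple_box R d (fun j => @unit_slab R m (b j))); last by move=> j; apply: measurable_unit_slab.
have -> : (m.+1%:R ^+ d)^-1 = \prod_(j < d) (m.+1%:R^-1 : R) by rewrite prodr_const card_ord exprVn.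
rewrite -prodEFin.
(* Nonnegativity is carried along because multiplying the inequalities requires it. *)
suff : forall r : seq 'I_d, (0 <= \prod_(j <- r) lebesgue_measure (@unit_slab R m (b j)) <=
   \prod_(j <- r) (m.+1%:R^-1 : R)%:E)%E by move=> /(_ (index_enum _)) /andP[].
elim=> [|j r /andP[IH0 IH]]; first by rewrite !big_nil lexx lee_fin ler01.
rewrite !big_cons mule_ge0 ?measure_ge0 //=.
by apply: lee_pmul => //; apply: lebesgue_unit_slab.
Qed.

Lemma sum_cell_prob v : \sum_b cell_prob v b = 1.
Proof.
have [_] := @finite_law R disp Omega P _ (fun w => cell_of (X v w)) (measurable_cell_event v) (fun=> True).
rewrite (_ : [set w | True] = setT) ?probability_setT; last by apply/seteqP; split.
rewrite (eq_bigl predT); last by move=> b; apply/asboolP.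
under eq_bigr do rewrite cell_probE.
by rewrite sumEFin => -[].
Qed.

Definition config_event (x : {ffun 'I_n -> cell} * {ffun vertex_pair n -> bool}) :=
  [set w | (cells w, bits w) = x].

Let part (x : {ffun 'I_n -> cell} * {ffun vertex_pair n -> bool}) (k : 'I_n + vertex_pair n) :
    set Omega :=
  match k with
  | inl v => [set w | cell_of (X v w) = x.1 v]
  | inr e => [set w | G w (val e).1 (val e).2 = x.2 e]
  end.

Lemma measurable_edge_event (e : vertex_pair n) (b : bool) :
  measurable [set w | G w (val e).1 (val e).2 = b].
Proof.
have mG := edge_measurable H (val e).1 (val e).2; case: b; first exact: mG.
rewrite (_ : [set w | _] = ~` [set w | G w (val e).1 (val e).2]); first exact: measurableC.
by apply/seteqP; split=> w /=; [move=> -> //|move/negP/negbTE].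
Qed.

Lemma edge_event_prob (e : vertex_pair n) (b : bool) :
  P [set w | G w (val e).1 (val e).2 = b] = (if b then p else 1 - p)%:E.
Proof.
have ne : (val e).1 != (val e).2 by have := valP e; rewrite neq_ltn => ->.
have Pe := edge_probability H ne; case: b; first exact: Pe.
rewrite (_ : [set w | _] = ~` [set w | G w (val e).1 (val e).2]).
  by rewrite probability_setC ?Pe //; apply: edge_measurable H _ _.
by apply/seteqP; split=> w /=; [move=> -> //|move/negP/negbTE].
Qed.

Lemma config_eventE x : config_event x = \bigcap_(k in [set` [set: 'I_n + vertex_pair n]%SET]) part x k.
Proof.
apply/seteqP; split=> [w /= <- [v|e] _ /=|w h]; rewrite ?ffunE //.
case: x h => c g h; congr (_, _).
  by apply/ffunP => v; rewrite ffunE; apply: (h (inl v)); rewrite /= finset.in_setT.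
by apply/ffunP => e; rewrite ffunE; apply: (h (inr e)); rewrite /= finset.in_setT.
Qed.

Lemma measurable_config_event x : measurable (config_event x).
Proof.
rewrite config_eventE; apply: fin_bigcap_measurable; first exact: finite_finset.
move=> [v|e] _; [exact: measurable_cell_event|exact: measurable_edge_event].
Qed.

(** The place where joint independence enters: a configuration prescribes one generated event for
    every vertex and every pair. *)
Lemma config_prob x : P (config_event x) = (config_weight cell_prob p x)%:E.
Proof.
rewrite config_eventE (joint_independence H); last first.
  move=> [v|e] _ /=.
    by exists [set y | cell_of y = x.1 v] => //; apply: measurable_cell.
  by exists [set b | b = x.2 e].
rewrite (eq_bigl predT); last by move=> k; rewrite finset.in_setT.
rewrite big_sumType /= /config_weight EFinM /bern -!prodEFin; congr (_ * _)%E.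
  by apply: eq_bigr => v _; rewrite cell_probE.
by apply: eq_bigr => e _; rewrite edge_event_prob.
Qed.

Lemma config_law (Q : {ffun 'I_n -> cell} * {ffun vertex_pair n -> bool} -> Prop) :
  measurable [set w | Q (cells w, bits w)] /\
  P [set w | Q (cells w, bits w)] = (mass (config_weight cell_prob p) Q)%:E.
Proof.
have [m1 P1] := @finite_law R disp Omega P _ (fun w => (cells w, bits w)) measurable_config_event Q.
by split=> //; rewrite P1 /mass -sumEFin; apply: eq_bigr => x _; apply: config_prob.
Qed.

End Discretization.

(** * Tour lengths *)

Section Tsp.
Context {R : realType} {d n : nat}.
Variables (x : 'I_n -> d.-tuple R) (e : rel 'I_n).
Local Open Scope ring_scope.

Lemma tsp_le_tour (s : n.-tuple 'I_n) : hamilton_cycle e s ->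
  (tsp x e <= (tour_length x s)%:E)%E.
Proof.
move=> hs; rewrite /tsp; have := @ge_bigmin_seq _ _ _ (index_enum (n.-tuple 'I_n)) +oo%E s
  (hamilton_cycle e) (fun s => (tour_length x s)%:E) (mem_index_enum s) hs; exact.
Qed.

Lemma tsp_leP (C : R) : (tsp x e <= C%:E)%E <->
  exists2 s : n.-tuple 'I_n, hamilton_cycle e s & tour_length x s <= C.
Proof.
split=> [h|[s hs hC]]; last first.
  by apply: le_trans (tsp_le_tour hs) _; rewrite lee_fin.
apply: contrapT => ns; move: h; apply/negP; rewrite -ltNge /tsp.
elim/big_ind: _ => [|a b ha hb|s hs]; first exact: ltry.
  by rewrite lt_min ha.
by rewrite lte_fin ltNge; apply/negP => h; apply: ns; exists s.
Qed.

Lemma tsp_geP (c : R) : (c%:E <= tsp x e)%E <->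
  forall s : n.-tuple 'I_n, hamilton_cycle e s -> c <= tour_length x s.
Proof.
split=> [h s hs|h]; last by apply: le_bigmin => [|s /h]; rewrite ?leey ?lee_fin.
by rewrite -lee_fin; apply: le_trans h (tsp_le_tour hs).
Qed.

Lemma csteps_next (T : eqType) (s : seq T) : uniq s -> csteps s = [seq (i, next s i) | i <- s].
Proof.
case: s => [|a s] // us.
have sz : size (csteps (a :: s)) = (size s).+1 by rewrite csteps_cons size_rcons size_steps.
apply: (@eq_from_nth _ (a, a)) => [|i]; first by rewrite sz size_map.
rewrite sz => hi; rewrite (nth_map a) //.
rewrite /csteps /steps nth_zip_cond -[size (zip _ _)]/(size (csteps (a :: s))) sz hi.
have -> : nth (a, a).1 (a :: rcons s a) i = nth a (a :: s) i.
  by rewrite -rcons_cons nth_rcons /= hi.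
(* At the last position [next] returns the default, the head [a], which is the closing entry on the
   other side. *)
congr (_, _); rewrite next_nth mem_nth // index_uniq //= nth_rcons.
by case: ltngtP => // hs; rewrite nth_default // ?hs // ltnW.
Qed.

Definition edge_length (u v : 'I_n) : R := euclidean_dist (x u) (x v).

Lemma tour_lengthE (s : n.-tuple 'I_n) : uniq s -> tour_length x s = cwsum edge_length s.
Proof. by move=> us; rewrite /cwsum csteps_next // big_map. Qed.

Lemma hamilton_of_order (s : seq 'I_n) : (2 < n)%N -> perm_eq s (enum 'I_n) -> cgaps e s = 0%N ->
  exists2 t : n.-tuple 'I_n, val t = s & hamilton_cycle e t.
Proof.
move=> n3 ps gs; have szs : size s == n by rewrite (perm_size ps) size_enum_ord.
exists (Tuple szs) => //; rewrite /hamilton_cycle n3 /ucycleb /=.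
rewrite (perm_uniq ps) enum_uniq andbT; case: s {ps szs} gs => // a s gs.
rewrite /= path_steps -[all _ _]negbK -has_predC has_count -lt0n.
by rewrite (eq_count (a2 := fun q => ~~ e q.1 q.2)) // [count _ _]gs.
Qed.

Lemma euclidean_distC (u v : d.-tuple R) : euclidean_dist u v = euclidean_dist v u.
Proof.
rewrite /euclidean_dist; congr Num.sqrt; apply: eq_bigr => j _.
by rewrite -sqrrN opprB.
Qed.

Lemma euclidean_dist_le (u v : d.-tuple R) (b : R) : 0 <= b ->
  (forall j, `|tnth u j - tnth v j| <= b) -> euclidean_dist u v <= Num.sqrt d%:R * b.
Proof.
move=> b0 h; have -> : Num.sqrt d%:R * b = Num.sqrt (d%:R * b ^+ 2) :> R.
  by rewrite sqrtrM // sqrtr_sqr ger0_norm.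
rewrite /euclidean_dist ler_wsqrtr //.
apply: (@le_trans _ _ (\sum_(j < d) b ^+ 2)).
  by apply: ler_sum => j _; rewrite -[X in X <= _]real_normK ?num_real // lerXn2r ?nnegrE.
by rewrite sumr_const card_ord mulr_natl.
Qed.

Lemma euclidean_dist_ge (u v : d.-tuple R) j : `|tnth u j - tnth v j| <= euclidean_dist u v.
Proof.
rewrite -sqrtr_sqr /euclidean_dist ler_wsqrtr // (bigD1 j) //= lerDl.
by apply: sumr_ge0 => i _; apply: sqr_ge0.
Qed.

End Tsp.

Section Geometry.
Context {R : realType} {d n m : nat}.
Variables (x : 'I_n -> d.-tuple R).
Local Open Scope ring_scope.
Hypothesis x01 : forall i, unit_cube (x i).
Local Notation c i := (cell_of m (x i)).

(** Indices with equal quotient by 2^k differ by at most 2^k - 1, and the missing 1 is the width of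
    a cell. *)
Lemma same_cell_dist J k i j : m.+1 = (2 ^ J)%N -> same_cell k (c i) (c j) ->
  euclidean_dist (x i) (x j) <= Num.sqrt d%:R * (2 ^+ k / 2 ^+ J).
Proof.
move=> mJ h; apply: euclidean_dist_le => [|l]; first by rewrite divr_ge0 ?exprn_ge0.
have := h l; rewrite !ffunE => hl.
have /andP[a1 a2] := slab_index_bounds m (x01 i l).
have /andP[b1 b2] := slab_index_bounds m (x01 j l).
move: hl a1 a2 b1 b2; move: (slab_index m (tnth (x i) l)) (slab_index m (tnth (x j) l)) => a b hl.
have ga := divn_eq a (2 ^ k); have gb := divn_eq b (2 ^ k).
have la : (a %% 2 ^ k < 2 ^ k)%N by rewrite ltn_mod expn_gt0.
have lb : (b %% 2 ^ k < 2 ^ k)%N by rewrite ltn_mod expn_gt0.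
rewrite hl in ga.
have hab : (a.+1 <= b + 2 ^ k)%N by rewrite ga {1}gb; lia.
have hba : (b.+1 <= a + 2 ^ k)%N by rewrite ga {1}gb; lia.
have -> : m.+1%:R = 2 ^+ J :> R by rewrite mJ natrX.
move: hab hba; rewrite -!(ler_nat R) !natrD !natrX => hab hba a1 a2 b1 b2.
have J0 : 0 < 2 ^+ J :> R by rewrite exprn_gt0.
rewrite ler_norml -mulNr ler_pdivrMr // ler_pdivlMr // [(_ - _) * _]mulrC mulrBr.
by apply/andP; split; lra.
Qed.

Lemma cell_dist_le i j : (cell_dist (c i) (c j))%:R <=
  d%:R * (m.+1%:R * euclidean_dist (x i) (x j) + 1) :> R.
Proof.
rewrite /cell_dist natr_sum.
apply: (@le_trans _ _ (\sum_(l < d) (m.+1%:R * euclidean_dist (x i) (x j) + 1))); last first.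
  by rewrite sumr_const card_ord [leRHS]mulr_natl.
apply: ler_sum => l _; rewrite !ffunE.
have /andP[a1 a2] := slab_index_bounds m (x01 i l).
have /andP[b1 b2] := slab_index_bounds m (x01 j l).
have h := euclidean_dist_ge (x i) (x j) l.
have m0 : 0 < m.+1%:R :> R by [].
have := ler_wpM2l (ltW m0) h; rewrite -{1}[m.+1%:R]gtr0_norm // -normrM mulrBr => h'.
move: h'; rewrite ler_norml => /andP[h1 h2].
move: (slab_index m _) (slab_index m _) a1 a2 b1 b2 => a b; rewrite -[a.+1%:R]natr1 -[b.+1%:R]natr1 => a1 a2 b1 b2.
have [ab|ba] := leqP a b.
  rewrite (_ : (a - b = 0)%N) ?add0n ?addn0 ?natrB //; last by apply/eqP; rewrite subn_eq0.
  lra.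
rewrite (_ : (b - a = 0)%N) ?add0n ?addn0 ?natrB ?(ltnW ba) //; last by apply/eqP; rewrite subn_eq0 ltnW.
lra.
Qed.

(** Explains the threshold 2dn: rounding to cells accounts for at most dn of the total cell
    distance, so a further dn must come from the length. *)
Lemma long_tour (e : rel 'I_n) (g : {ffun vertex_pair n -> bool}) (s : n.-tuple 'I_n) :
  (0 < d)%N -> graph_of g = e -> ~ has_short_path [ffun i => c i] g -> hamilton_cycle e s ->
  n%:R / m.+1%:R <= tour_length x s.
Proof.
move=> d0 ge nsp /andP[_ /andP[cs us]]; rewrite tour_lengthE //.
have m0 : 0 < m.+1%:R :> R by [].
have d0' : 0 < d%:R :> R by rewrite ltr0n.
have hD : (2 * d * n < \sum_(q <- steps s) cell_dist (c q.1) (c q.2))%N.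
  rewrite ltnNge; apply/negP => h; apply: nsp; exists s; split=> //.
  - by rewrite size_tuple.
  - rewrite ge; case: (val s) cs => // a l; rewrite /= rcons_path => /andP[] //.
  - apply: leq_trans h; rewrite leq_eqVlt; apply/orP; left; apply/eqP.
    by apply: eq_bigr => q _; rewrite !ffunE.
apply: (@le_trans _ _ (wsum (edge_length x) s)); last first.
  case: (val s) => [|a l]; first by rewrite /wsum /cwsum !big_nil.
  by rewrite cwsum_cons lerDl sqrtr_ge0.
move: hD; rewrite -(ltr_nat R) natr_sum => hD.
have : \sum_(q <- steps s) (cell_dist (c q.1) (c q.2))%:R <=
    \sum_(q <- steps s) d%:R * (m.+1%:R * edge_length x q.1 q.2 + 1).
  by apply: ler_sum => q _; apply: cell_dist_le.
rewrite -big_distrr /= big_split /= -big_distrr /= -[\sum_(_ <- _) edge_length _ _ _]/(wsum _ s).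
have -> : \sum_(q <- steps s) (1 : R) = (n.-1)%:R.
  by rewrite -(natr_sum _ _ _ (fun=> 1%N)) sum1_size size_steps size_tuple.
have hn : (n.-1)%:R <= n%:R :> R by rewrite ler_nat leq_pred.
move: hD; rewrite !natrM => hD h; rewrite ler_pdivrMr // mulrC.
have := lt_le_trans hD h; rewrite -mulrA mulrCA ltr_pM2l // => h'.
by apply/ltW; lra.
Qed.

End Geometry.

Lemma mass_short_path_gt0 (R : realType) (n d m : nat)
    (w : 'I_n -> {ffun 'I_d -> 'I_m.+1} -> R) (p : R) : (0 < n)%N ->
  (forall v b, 0 <= w v b <= (m.+1%:R ^+ d)^-1)%R -> (0 <= p <= 1)%R ->
  (2 * 16 ^+ d * n%:R * p <= m.+1%:R ^+ d)%R ->
  (mass (config_weight w p) (fun x => has_short_path x.1 x.2) <= 4 * 4 ^+ d / n%:R)%R.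
Proof. case: n w => [//|n] w _; exact: mass_short_path. Qed.

(** * Measurability and the failure probability for fixed n *)

Section FixedSize.
Context {R : realType} {disp : measure_display} {Omega : measurableType disp}.
Variables (P : probability Omega R) (d n : nat) (p : R).
Variables (X : 'I_n -> Omega -> d.-tuple R) (G : Omega -> rel 'I_n).
Hypothesis H : embedded_random_graph P p X G.
Local Open Scope classical_set_scope.
Local Open Scope ring_scope.
Local Notation pos w := (fun i => X i w).

Lemma measurable_coordinate i j : measurable_fun [set: Omega] (fun w => tnth (X i w) j).
Proof.
have [mX _] := position_uniform H i.
by apply: (measurableT_comp (measurable_tnth j) mX).
Qed.

Lemma measurable_edge_length i j :
  measurable_fun [set: Omega] (fun w => euclidean_dist (X i w) (X j w)).
Proof.
rewrite /euclidean_dist; apply: measurableT_comp.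
  by apply: continuous_measurable_fun; apply: sqrt_continuous.
apply: measurable_sum => l; apply: measurable_funX; apply: measurable_funB;
  exact: measurable_coordinate.
Qed.

Lemma measurable_tour_length (s : n.-tuple 'I_n) :
  measurable_fun [set: Omega] (fun w => tour_length (pos w) s).
Proof. by apply: measurable_sum => i; apply: measurable_edge_length. Qed.

Lemma measurable_hamilton (s : n.-tuple 'I_n) :
  measurable [set w | hamilton_cycle (G w) s].
Proof.
have [mQ _] := config_law H (m := 0) (fun x => hamilton_cycle (graph_of x.2) s).
rewrite (_ : [set w | _] = [set w | hamilton_cycle (graph_of (bits G w)) s]) //.
by apply/seteqP; split=> w /=; rewrite (graph_of_bits H).
Qed.

Lemma measurable_tsp_between (lo hi : R) :
  measurable [set w | (lo%:E <= tsp (pos w) (G w) <= hi%:E)%E].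
Proof.
have -> : [set w | (lo%:E <= tsp (pos w) (G w) <= hi%:E)%E] =
  (\bigcap_(s in [set: n.-tuple 'I_n]) (~` [set w | hamilton_cycle (G w) s] `|`
     (fun w => tour_length (pos w) s) @^-1` `[lo, +oo[)) `&`
  (\bigcup_(s in [set: n.-tuple 'I_n]) ([set w | hamilton_cycle (G w) s] `&`
     (fun w => tour_length (pos w) s) @^-1` `]-oo, hi])).
  apply/seteqP; split=> w /=.
    case/andP=> /tsp_geP hlo /tsp_leP[s hs hhi]; split.
      move=> t _; have [ht|ht] := pselect (hamilton_cycle (G w) t); last by left.
      by right; rewrite /= in_itv /= andbT; apply: hlo.
    by exists s => //; split=> //; rewrite /= in_itv.
  case=> h1 [s _ [hs]]; rewrite /= in_itv /= => hhi; apply/andP; split.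
    apply/tsp_geP => t ht; case: (h1 t I) => [/(_ ht) //|].
    by rewrite /= in_itv /= andbT.
  by apply/tsp_leP; exists s.
have mlen s I0 : measurable I0 -> measurable ((fun w => tour_length (pos w) s) @^-1` I0).
  by move=> mI; rewrite -[X in measurable X]setTI; apply: measurable_tour_length.
apply: measurableI.
  apply: fin_bigcap_measurable => // s _; apply: measurableU; last exact: mlen.
  by apply: measurableC; apply: measurable_hamilton.
apply: fin_bigcup_measurable => // s _; apply: measurableI; last exact: mlen.
exact: measurable_hamilton.
Qed.

Lemma measurable_unit_cube : measurable (@unit_cube R d).
Proof.
have -> : @unit_cube R d = \bigcap_(j in [set: 'I_d])
    ((fun x : d.-tuple R => tnth x j) @^-1` `[0, 1]).
  apply/seteqP; split=> x /= h j; first by move=> _; rewrite /= in_itv; apply: h.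
  by have := h j I; rewrite /= in_itv.
apply: fin_bigcap_measurable => // j _; rewrite -[X in measurable X]setTI.
by apply: measurable_tnth.
Qed.

(** Uniformity places the points in the cube only almost surely, whereas the geometric estimates are
    pointwise; the exceptional set has to be removed explicitly. *)
Lemma outside_cube : measurable [set w | exists i, ~ unit_cube (X i w)] /\
  P [set w | exists i, ~ unit_cube (X i w)] = 0%E.
Proof.
suff h (r : seq 'I_n) : measurable [set w | exists2 i, i \in r & ~ unit_cube (X i w)] /\
    P [set w | exists2 i, i \in r & ~ unit_cube (X i w)] = 0%E.
  rewrite (_ : [set w | exists i, _] =
    [set w | exists2 i, i \in enum 'I_n & ~ unit_cube (X i w)]) //.
  apply/seteqP; split=> w /= [i]; last by exists i.
  by exists i; rewrite ?mem_enum.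
elim: r => [|i r [mr Pr]].
  rewrite (_ : [set w | _] = set0) ?measure0; last by apply/seteqP; split=> w // -[].
  by split.
have [mX uX] := position_uniform H i.
have mC : measurable (~` @unit_cube R d) by apply: measurableC; apply: measurable_unit_cube.
have mi : measurable (X i @^-1` (~` @unit_cube R d)).
  by rewrite -[X in measurable X]setTI; apply: mX.
have Pi : P (X i @^-1` (~` @unit_cube R d)) = 0%E.
  by rewrite uX // setICl lebesgue_tuple0.
rewrite (_ : [set w | _] = [set w | exists2 j, j \in r & ~ unit_cube (X j w)] `|`
    X i @^-1` (~` @unit_cube R d)); last first.
  apply/seteqP; split=> w /=.
    by case=> j; rewrite inE => /orP[/eqP->|jr] hj; [right|left; exists j].
  by case=> [[j jr hj]|hi]; [exists j; rewrite ?inE ?jr ?orbT|exists i; rewrite ?inE ?eqxx].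
by split; [apply: measurableU|rewrite measureU0].
Qed.

(** Two unrelated grids occur: a dyadic one with 2^J cells per axis, coarse enough for edges inside
    cells, and one with m + 1 cells per axis, fine enough to make nearby edges rare. *)
Lemma tsp_between_prob (J k m : nat) (q lo hi : R) : (2 <= d)%N -> (2 < n)%N ->
  expR 1 * 2 <= n%:R :> R -> 0 <= p <= 1 -> k.+1 = (2 ^ J)%N ->
  0 <= q <= 1 -> 1 - p = (1 - q) ^+ 2 ->
  2592 * ln n%:R <= q * n%:R -> 24 * 2 ^+ (d * J) <= q * n%:R ->
  2 * 16 ^+ d * n%:R * p <= m.+1%:R ^+ d ->
  lo <= n%:R / m.+1%:R -> Num.sqrt d%:R * (105 * n%:R / 2 ^+ J) <= hi ->
  (P (~` [set w | (lo%:E <= tsp (pos w) (G w) <= hi%:E)%E]) <=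
    ((2 * expR 1 + 15 ^+ 15 + 1 + 4 * 4 ^+ d) / n%:R)%:E)%E.
Proof.
move=> d2 n3 ne p01 kJ q01 hq hln hJ hm hlo hhi.
have n0 : (0 < n)%N by apply: leq_trans n3.
have d0 : (0 < d)%N by apply: leq_trans d2.
have [mU PU] := config_law H (m := k) (fun x => ~ has_short_tour R J x.1 x.2).
have [mL PL] := config_law H (m := m) (fun x => has_short_path x.1 x.2).
have [mN PN] := outside_cube.
set U := [set w | _] in mU PU; set L := [set w | _] in mL PL; set N := [set w | _] in mN PN.
apply: (@le_trans _ _ (P ((U `|` L) `|` N))).
  apply: le_measure; rewrite ?inE.
  - by apply: measurableC; apply: measurable_tsp_between.
  - by apply: measurableU => //; apply: measurableU.
  move=> w; apply: contra_notP => /= /not_orP[/not_orP[nU nL] nN].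
  have x01 i : unit_cube (X i w) by apply: contrapT => h; apply: nN; exists i.
  apply/andP; split.
    apply/tsp_geP => s hs; apply: le_trans hlo _.
    by apply: (long_tour x01 d0 (graph_of_bits H w) nL hs).
  move/contrapT: nU => /= st.
  have sd : 0 < Num.sqrt d%:R :> R by rewrite sqrtr_gt0 ltr0n.
  (* The square root of d is the diameter of the cube, so these weights are at most 1. *)
  pose F u v := edge_length (pos w) u v / Num.sqrt d%:R.
  have nF : normal_weight F.
    split=> u v; first by rewrite /F /edge_length euclidean_distC.
    rewrite divr_ge0 ?sqrtr_ge0 //= ler_pdivrMr // mulrC.
    apply: euclidean_dist_le => // j; have /andP[u1 u2] := x01 u j; have /andP[v1 v2] := x01 v j.
    by rewrite ler_norml; apply/andP; split; lra.
  have [i u v hi' |s [ps gs ws]] := st F nF.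
    rewrite !ffunE => h; rewrite ler_pdivrMr // mulrC.
    exact: (same_cell_dist x01 kJ h).
  rewrite (graph_of_bits H) in gs.
  have [t Et ht] := hamilton_of_order n3 ps gs.
  apply/tsp_leP; exists t => //; apply: le_trans hhi.
  rewrite tour_lengthE ?Et; last by rewrite (perm_uniq ps) enum_uniq.
  have -> : cwsum (edge_length (pos w)) s = Num.sqrt d%:R * cwsum F s.
    rewrite /cwsum big_distrr /=; apply: eq_bigr => e _.
    by rewrite /F mulrCA divff ?mulr1 // gt_eqF.
  by rewrite ler_wpM2l ?sqrtr_ge0.
rewrite measureU0 //; last exact: measurableU.
apply: le_trans (measureU2 _ mU mL) _; rewrite mulrDl EFinD; apply: leeD.
  apply: (@le_trans _ _ (P U)) => //; rewrite PU lee_fin.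
  apply: (@mass_config_le R n d k (cell_prob P X (m := k)) p _ (fun c g => ~ has_short_tour R J c g)).
  - by move=> v b; have /andP[] := cell_prob_bound H v b.
  - by move=> v; apply: (sum_cell_prob H k v).
  - by move=> c; apply: (mass_no_short_tour kJ d2 c q01 hq hln hJ n3 ne).
apply: (@le_trans _ _ (P L)) => //; rewrite PL lee_fin.
by apply: mass_short_path_gt0 => // v b; apply: (cell_prob_bound H v b).
Qed.

End FixedSize.

(** * Choice of the scales and constants *)

Section Rates.
Variable R : realType.
Local Open Scope ring_scope.

(** With rho = (np)^(1/d) the rate is n/rho: n steps of the typical length 1/rho of a short edge. *)
Lemma rate_root (d n : nat) (p : R) : (0 < d)%N -> (0 < n)%N -> 0 <= p -> 1 <= p * n%:R ->
  exists rho : R, [/\ 1 <= rho, rho ^+ d = p * n%:R & tsp_rate d n p = n%:R / rho].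
Proof.
move=> d0 n0 p0 h1; have n0' : 0 < n%:R :> R by rewrite ltr0n.
have d0' : d%:R != 0 :> R by rewrite pnatr_eq0 -lt0n.
have y0 : 0 <= p * n%:R by apply: le_trans h1.
pose rho : R := (p * n%:R) `^ (d%:R^-1).
have E : rho ^+ d = p * n%:R.
  by rewrite -powR_mulrn ?powR_ge0 // -powRrM mulVf // powRr1.
exists rho; split=> //.
  rewrite leNgt; apply/negP => lt1; move: h1; rewrite -E leNgt => /negP; apply.
  by rewrite exprn_ilt1 ?powR_ge0 // -lt0n.
have -> : tsp_rate d n p = n%:R `^ (1 - d%:R^-1) / p `^ (d%:R^-1).
  by rewrite /tsp_rate mulrBl divff // mul1r.
rewrite powRD; last by apply/implyP => _; rewrite gt_eqF.
by rewrite powRr1 // powRN /rho powRM // invfM mulrA mulrAC.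
Qed.

Lemma half_exposure (p : R) : 0 <= p <= 1 ->
  exists q, [/\ 0 <= q <= 1, 1 - p = (1 - q) ^+ 2 & p / 2 <= q].
Proof.
move=> /andP[p0 p1]; exists (1 - Num.sqrt (1 - p)).
have h : Num.sqrt (1 - p) <= 1 - p / 2.
  rewrite -[leRHS]ger0_norm; last by lra.
  by rewrite -sqrtr_sqr ler_wsqrtr // expr2; nra.
have h0 := sqrtr_ge0 (1 - p).
split; [|by rewrite subKr sqr_sqrtr // subr_ge0|lra].
by apply/andP; split; lra.
Qed.

Lemma finest_scale (d : nat) (y : R) : (0 < d)%N -> 24 <= y ->
  exists J, 24 * 2 ^+ (d * J) <= y < 24 * 2 ^+ (d * J.+1).
Proof.
move=> d0 hy; pose Q J := 24 * 2 ^+ (d * J) <= y.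
have ex : exists J, Q J by exists 0%N; rewrite /Q muln0 expr0 mulr1.
have bd J : Q J -> (J <= Num.truncn y)%N.
  rewrite /Q => h; rewrite truncn_ge_nat; last by lra.
  apply: le_trans h; apply: (@le_trans _ _ (2 ^+ (d * J))); last first.
    by rewrite ler_peMl ?exprn_ge0 //; lra.
  rewrite -natrX ler_nat; apply: leq_trans (ltnW (ltn_expl J (isT : 1 < 2)%N)) _.
  by rewrite leq_exp2l // leq_pmull.
have [J QJ maxJ] := ex_maxnP ex bd; exists J; rewrite [X in X && _]QJ /= ltNge.
by apply/negP => /maxJ; rewrite ltnn.
Qed.

End Rates.

Local Open Scope classical_set_scope.
Local Open Scope ring_scope.

(** 5184 = 2 * 2592, since q is at least p/2. 33 comes from rounding 32 rho, where 32^d >= 2 * 16^d.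
    10080 = 105 * 96, where 96 compares rho with 2^J. *)
Lemma tsp_rate_prob {R : realType} {disp : measure_display} {Omega : measurableType disp}
    (P : probability Omega R) (d n : nat) (p : R) (X : 'I_n -> Omega -> d.-tuple R)
    (G : Omega -> rel 'I_n) :
  embedded_random_graph P p X G -> (2 <= d)%N -> (2 < n)%N -> expR 1 * 2 <= n%:R :> R ->
  0 <= p <= 1 -> 5184 * ln n%:R <= p * n%:R ->
  (P (~` [set w | ((33^-1 * tsp_rate d n p)%:E <= tsp (fun i => X i w) (G w)
      <= (10080 * Num.sqrt d%:R * tsp_rate d n p)%:E)%E]) <=
    ((2 * expR 1 + 15 ^+ 15 + 1 + 4 * 4 ^+ d) / n%:R)%:E)%E.
Proof.
move=> HG d2 n3 ne p01 hp.
have d0 : (0 < d)%N by apply: leq_trans d2.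
have sd : 0 < Num.sqrt d%:R :> R by rewrite sqrtr_gt0 ltr0n.
have n0 : (0 < n)%N by apply: leq_trans n3.
have n0' : 0 < n%:R :> R by rewrite ltr0n.
have ln1 : 1 <= ln n%:R :> R.
  rewrite -[X in X <= _]expRK ler_ln ?posrE ?expR_gt0 //; apply: le_trans ne.
  by rewrite ler_peMr ?expR_ge0 // ler1n.
have pn1 : 1 <= p * n%:R by lra.
have pn24 : 24 * 2 <= p * n%:R by lra.
have [q [q01 hq hpq]] := half_exposure p01.
have hpq' : p * n%:R / 2 <= q * n%:R by rewrite mulrAC ler_wpM2r // ltW.
have hqn : 2592 * ln n%:R <= q * n%:R by lra.
have pn0 : 0 <= p by have /andP[] := p01.
have [rho [rho1 rhoE rateE]] := rate_root d0 n0 pn0 pn1.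
have [|J /andP[J1 J2]] := @finest_scale R d (q * n%:R) d0.
  by apply: le_trans hpq'; rewrite ler_pdivlMr.
have rho0 : 0 < rho by apply: lt_le_trans rho1.
have J0 : 0 < 2 ^+ J :> R by rewrite exprn_gt0.
(* Maximality of J gives np <= 2qn < 48 * 2^(d(J+1)), which is at most (48 * 2^(J+1))^d. *)
have rhoJ : rho <= 96 * 2 ^+ J.
  rewrite leNgt; apply/negP => lt; move: J2; rewrite ltNge => /negP; apply.
  have : (96 * 2 ^+ J) ^+ d <= rho ^+ d.
    by rewrite lerXn2r ?nnegrE ?mulr_ge0 ?(ltW rho0) ?(ltW J0) // ltW.
  rewrite rhoE => h.
  have : 48 * 2 ^+ (d * J.+1) <= (96 * 2 ^+ J) ^+ d :> R.
    rewrite (_ : 96 * 2 ^+ J = 48 * 2 ^+ J.+1 :> R); last by rewrite exprS mulrA; congr (_ * _); lra.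
    rewrite exprMn -exprM [(d * _)%N]mulnC ler_wpM2r ?exprn_ge0 //.
    by rewrite -[X in X <= _]expr1 ler_weXn2l //; lra.
  move=> h'; have := le_trans h' h; move: hpq'; lra.
pose m := Num.truncn (32 * rho).
have m1 : 32 * rho <= m.+1%:R by apply/ltW/truncnS_gt.
have m2 : m.+1%:R <= 33 * rho.
  have r32 : 0 <= 32 * rho by lra.
  by have /andP[h _] := truncn_itv r32; rewrite -[m.+1%:R]natr1; move: h; rewrite -/m; lra.
apply: (tsp_between_prob HG (J := J) (k := (2 ^ J).-1) (m := m) (q := q)
   d2 n3 ne p01 _ q01 hq hqn J1 _ _ _).
+ by rewrite prednK ?expn_gt0.
+ apply: (@le_trans _ _ ((32 * rho) ^+ d)); last first.
    by rewrite lerXn2r ?nnegrE ?mulr_ge0 ?(ltW rho0).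
  rewrite exprMn rhoE -!mulrA [n%:R * _]mulrC mulrA ler_wpM2r ?mulr_ge0 ?(ltW n0') //.
  rewrite (_ : 32 = 2 * 16 :> R); last by lra.
  by rewrite exprMn ler_wpM2r ?exprn_ge0 // -[X in X <= _]expr1 ler_weXn2l //; lra.
+ by rewrite rateE mulrCA ler_wpM2l ?(ltW n0') // -invfM lef_pV2 ?posrE ?mulr_gt0 //.
+ have hJ : (2 ^+ J)^-1 <= 96 / rho :> R.
    by rewrite ler_pdivlMr // mulrC ler_pdivrMr.
  rewrite rateE; apply: (@le_trans _ _ (Num.sqrt d%:R * (105 * n%:R * (96 / rho)))).
    by rewrite ler_wpM2l ?(ltW sd) // ler_wpM2l // mulr_ge0.
  by rewrite le_eqVlt; apply/orP; left; apply/eqP; ring.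
Qed.

Theorem theorem1p2 (R : realType) :
  exists K : R, 0 < K /\
  forall (d : nat) (p : nat -> R),
    (2 <= d)%N ->
    (forall n, 0 <= p n <= 1) ->
    (\forall n \near \oo, K * ln n%:R / n%:R <= p n) ->
  exists c C : R, [/\ 0 < c, 0 < C &
  forall (disp : nat -> measure_display)
         (Omega : forall n, measurableType (disp n))
         (P : forall n, probability (Omega n) R)
         (X : forall n, 'I_n -> Omega n -> d.-tuple R)
         (G : forall n, Omega n -> rel 'I_n),
    (forall n, embedded_random_graph (P n) (p n) (X n) (G n)) ->
    asymptotically_almost_surely P (fun n =>
      [set w | ((c * tsp_rate d n (p n))%:E <= tsp (fun i => X n i w) (G n w)
               <= (C * tsp_rate d n (p n))%:E)%E])].
Proof.
exists 5184; split=> [|d p d2 p01 hK]; first by lra.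
have sd : 0 < Num.sqrt d%:R :> R by rewrite sqrtr_gt0 ltr0n; apply: leq_trans d2.
have C0 : 0 < 10080 :> R by lra.
exists 33^-1, (10080 * Num.sqrt d%:R).
split; [by rewrite invr_gt0; lra|exact: mulr_gt0 C0 sd|].
move=> disp Omega P X G HG; rewrite /asymptotically_almost_surely.
set A : R := 2 * expR 1 + 15 ^+ 15 + 1 + 4 * 4 ^+ d.
have A0 : 0 <= A by rewrite !addr_ge0 ?mulr_ge0 ?expR_ge0 ?exprn_ge0.
have hA := fun n => @tsp_rate_prob R (disp n) (Omega n) (P n) d n (p n) (X n) (G n) (HG n) d2.
rewrite -/A in hA; move: A A0 hA => A A0 hA.
(* [harmonic n] is 1/(n+1); the factor 2 absorbs the shift. *)
apply: (@squeeze_cvge _ _ _ _ (cst 0%E) _ (fun n => ((2 * A) * harmonic n)%:E)).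
- near=> n; rewrite measure_ge0 /=.
  have n3 : (2 < n)%N by near: n; exact: nbhs_infty_gt.
  have ne : expR 1 * 2 <= n%:R :> R by near: n; exact: nbhs_infty_ger.
  have hp : 5184 * ln n%:R / n%:R <= p n by near: n.
  have n0' : 0 < n%:R :> R by rewrite ltr0n; apply: leq_trans n3.
  rewrite ler_pdivrMr // in hp; apply: le_trans (hA n n3 ne (p01 n) hp) _.
  rewrite lee_fin [2 * A]mulrC -mulrA ler_wpM2l // /harmonic /=.
  rewrite ler_pdivlMr ?ltr0n // mulrC ler_pdivrMr // -natrM ler_nat.
  by rewrite mul2n -addnn -addn1 leq_add2l; apply: leq_trans n3.
- exact: cvg_cst.
- apply: cvg_EFin; first by near=> n.
  rewrite -(mulr0 (2 * A)); apply: cvgMr; exact: cvg_harmonic.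
Unshelve. all: by end_near.
Qed.
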